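(* Let $X=X_1\times\cdots\times X_P\subset\mathbb{R}^p$, $Y=Y_1\times\cdots\times Y_Q\subset\mathbb{R}^q$, $Z\subset\mathbb{R}^r$ and $F:\mathbb{R}^p\times\mathbb{R}^q\times\mathbb{R}^r\to\mathbb{R}$, and let $\{(x^k,y^k,z^k)\}_{k\in\mathbb{N}}$ be a sequence generated by the Proximal Parallel Heterogeneous Block Implicit-Explicit Algorithm (described in the context) with $(x^0,y^0,z^0)\in X\times Y\times Z$. Suppose that: (i) $X_i\subset\mathbb{R}^{p_i}$, $Y_j\subset\mathbb{R}^{q_j}$ and $Z\subset\mathbb{R}^r$ are nonempty and closed, where $p_i,q_j,r$ are positive integers with $\sum_{i=1}^Pp_i=p$ and $\sum_{j=1}^Qq_j=q$. (ii) $F$ is differentiable on $X\times Y\times Z$ and $\inf F>-\infty$. Moreover, the partial gradients $\nabla_{x_i}F$ ($i=1,\dots,P$) and $\nabla_{y_j}F$ ($j=1,\dots,Q$) are Lipschitz continuous as functions of $x_i\in\mathbb{R}^{p_i}$, respectively $y_j\in\mathbb{R}^{q_j}$, with all other variables fixed, with moduli $L_{x_i}(y,z)$ and $L_{y_j}(x,z)$, respectively (the moduli do not depend on the other sub-blocks of $x$, respectively of $y$; see the context). (iii) $\nabla F$ is Lipschitz continuous on bounded domains in $X\times Y\times Z$, and there exist $\lambda_{x_i}^+,\lambda_{y_j}^+>0$ ($i=1,\dots,P$, $j=1,\dots,Q$) such that $\sup\{L_{x_i}(y^k,z^k):k\in\mathbb{N}\}\le\lambda_{x_i}^+$ and $\sup\{L_{y_j}(x^{k+1},z^k):k\in\mathbb{N}\}\le\lambda_{y_j}^+$.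 (iv) The iterates $\{(x^k,y^k,z^k)\}_{k\in\mathbb{N}}$ are bounded. (v) The function $\Psi(x,y,z)=F(x,y,z)+\iota_X(x)+\iota_Y(y)+\iota_Z(z)$ is a KL function. (vi) For $y\in Y$ and $z\in Z$ fixed, the function $x\mapsto\nabla_xF(x,y,z)$ is separable in $x$ in the sense that $\nabla_xF(x,y,z)=(g_1(x_1,y,z),\dots,g_P(x_P,y,z))$ for $x\in X$, where $g_i(\cdot,y,z):X_i\to\mathbb{R}^{p_i}$. (vii) For $x\in X$ and $z\in Z$ fixed, the function $y\mapsto\nabla_yF(x,y,z)$ is separable in $y$ in the sense that $\nabla_yF(x,y,z)=(h_1(x,y_1,z),\dots,h_Q(x,y_Q,z))$ for $y\in Y$, where $h_j(x,\cdot,z):Y_j\to\mathbb{R}^{q_j}$. Then: (a) The sequence has finite length, that is, $$\sum_{k=1}^\infty\|(x^{k+1},y^{k+1},z^{k+1})-(x^k,y^k,z^k)\|<\infty.$$ (b) The sequence converges to a point $(x^*,y^*,z^* )$ satisfying $$0\in\nabla F(x^*,y^*,z^* )+\partial\iota_X(x^* )\times\partial\iota_Y(y^* )\times\partial\iota_Z(z^* ).$$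
   Context: For a set $C$, $\iota_C$ is the indicator function: $\iota_C(x)=0$ if $x\in C$, $\iota_C(x)=+\infty$ otherwise. Moduli. For $y\in Y$, $z\in Z$, $L_{x_i}(y,z)$ is a number such that for every choice of the sub-blocks $x_l\in X_l$, $l\ne i$, the map $x_i\mapsto\nabla_{x_i}F(x_1,\dots,x_P,y,z)$ is Lipschitz continuous on $\mathbb{R}^{p_i}$ with constant $L_{x_i}(y,z)$; similarly, for $x\in X$, $z\in Z$ and every choice of $y_l\in Y_l$, $l\ne j$, the map $y_j\mapsto\nabla_{y_j}F(x,y_1,\dots,y_Q,z)$ is Lipschitz continuous on $\mathbb{R}^{q_j}$ with constant $L_{y_j}(x,z)$. For fixed $\eta_{x_i},\eta_{y_j}>0$ put $L_{x_i}'(y,z)=\max\{L_{x_i}(y,z),\eta_{x_i}\}$ and $L_{y_j}'(x,z)=\max\{L_{y_j}(x,z),\eta_{y_j}\}$. Proximal Parallel Heterogeneous Block Implicit-Explicit Algorithm. Choose $\alpha_i>1$ ($i=1,\dots,P$), $\beta_j>1$ ($j=1,\dots,Q$), $\gamma>0$ and $(x^0,y^0,z^0)\in X\times Y\times Z$. For $k=0,1,\dots$: 1. For each $i=1,\dots,P$, set $\alpha_i^k=\alpha_iL_{x_i}'(y^k,z^k)$ and select $x_i^{k+1}\in\operatorname{argmin}_{x_i\in X_i}\{\langle x_i-x_i^k,\nabla_{x_i}F(x^k,y^k,z^k)\rangle+\frac{\alpha_i^k}{2}\|x_i-x_i^k\|^2\}$. 2. For each $j=1,\dots,Q$, set $\beta_j^k=\beta_jL_{y_j}'(x^{k+1},z^k)$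 and select $y_j^{k+1}\in\operatorname{argmin}_{y_j\in Y_j}\{\langle y_j-y_j^k,\nabla_{y_j}F(x^{k+1},y^k,z^k)\rangle+\frac{\beta_j^k}{2}\|y_j-y_j^k\|^2\}$. 3. Select $z^{k+1}\in\operatorname{argmin}_{z\in Z}\{F(x^{k+1},y^{k+1},z)+\frac{\gamma}{2}\|z-z^k\|^2\}$. Subdifferential. For $f:\mathbb{R}^d\to(-\infty,+\infty]$ proper and lower semicontinuous and $u\in\operatorname{dom}f$, the regular (Fréchet) subdifferential $\widehat\partial f(u)$ is the set of $v\in\mathbb{R}^d$ with $\liminf_{w\to u,\,w\ne u}\frac{f(w)-f(u)-\langle v,w-u\rangle}{\|w-u\|}\ge0$, and $\widehat\partial f(u)=\emptyset$ for $u\notin\operatorname{dom}f$. The limiting subdifferential $\partial f(u)$ is the set of $v$ for which there exist $u^k\to u$ with $f(u^k)\to f(u)$ and $v^k\to v$ with $v^k\in\widehat\partial f(u^k)$. $\operatorname{dom}\partial f=\{u:\partial f(u)\neq\emptyset\}$. KL property. For $\eta\in(0,+\infty]$ let $\mathcal{C}_\eta$ be the set of continuous functions $\varphi:[0,\eta)\to\mathbb{R}_+$ with $\varphi(0)=0$, $\varphi$ of class $C^1$ on $(0,\eta)$ and $\varphi'(s)>0$ for all $s\in(0,\eta)$. A proper lower semicontinuous $f$ has the Kurdyka-Łojasiewicz (KL) property at $\bar u\in\operatorname{dom}\partial f$ if there exist $\eta\in(0,+\infty]$, a neighborhood $U$ of $\bar u$ and $\varphi\in\mathcal{C}_\eta$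 such that for all $u\in U$ with $f(\bar u)<f(u)<f(\bar u)+\eta$ one has $\varphi'(f(u)-f(\bar u))\,\operatorname{dist}(0,\partial f(u))\ge1$ (with $\operatorname{dist}(0,\emptyset)=+\infty$). $f$ is a KL function if it has the KL property at each point of $\operatorname{dom}\partial f$. *)

(* Defs.v *)
From HB Require Import structures.
From mathcomp Require Import all_boot all_order all_algebra.
From mathcomp Require Import all_classical all_reals all_analysis.

Set Implicit Arguments.
Unset Strict Implicit.
Unset Printing Implicit Defensive.

Import Order.TTheory GRing.Theory Num.Theory.
Import numFieldNormedType.Exports.

Local Open Scope classical_set_scope.
Local Open Scope ring_scope.

(* The library norm on 'rV[R]_n is the max norm, so the Euclidean structure is
   introduced here; topological notions (limits, neighborhoods, boundedness,
   differentiability) are taken from the library, since they coincide for the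
   two norms. *)
Section Euclidean.
Variables (R : realType) (n : nat).
Implicit Types (u v : 'rV[R]_n) (f : 'rV[R]_n -> R).

Definition dotv u v : R := \sum_(j < n) u 0 j * v 0 j.

Definition norm2 u : R := Num.sqrt (dotv u u).

(* Only meaningful at points where f is differentiable. *)
Definition grad f u : 'rV[R]_n := \row_(j < n) 'D_(delta_mx 0 j) f u.

Definition argmin (A : set 'rV[R]_n) f : set 'rV[R]_n :=
  [set u | A u /\ forall v, A v -> f u <= f v].

End Euclidean.

(* A point of R^(p_1) x ... x R^(p_N) is a row vector of length \sum_i p_i,
   whose i-th block is [submxrow x i]. *)
Section Blocks.
Variables (R : realType) (N : nat) (p : 'I_N -> nat).
Implicit Types (x : 'rV[R]_(\sum_i p i)) (f : 'rV[R]_(\sum_i p i) -> R).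

Definition set_block x (i : 'I_N) (u : 'rV[R]_(p i)) : 'rV[R]_(\sum_i p i) :=
  \mxrow_l dfwith (fun l => submxrow x l) i u l.

Definition block_prod (A : forall i, set 'rV[R]_(p i)) :
    set 'rV[R]_(\sum_i p i) :=
  [set x | forall i, A i (submxrow x i)].

Definition block_grad f (i : 'I_N) x : 'rV[R]_(p i) :=
  grad (fun u => f (set_block x u)) (submxrow x i).

(* The i-th block of x ranges over all of R^(p_i), the other blocks over the
   A_l; in particular the i-th partial gradient has to exist there. *)
Definition block_grad_lipschitz (A : forall i, set 'rV[R]_(p i)) f (i : 'I_N)
    (L : R) : Prop :=
  forall x, (forall l, l != i -> A l (submxrow x l)) ->
    (forall u : 'rV[R]_(p i), differentiable (fun v => f (set_block x v)) u) /\
    (forall u u' : 'rV[R]_(p i),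
       norm2 (block_grad f i (set_block x u) - block_grad f i (set_block x u'))
         <= L * norm2 (u - u')).

Definition separable_grad (A : forall i, set 'rV[R]_(p i)) f : Prop :=
  exists g : forall i, 'rV[R]_(p i) -> 'rV[R]_(p i),
    forall x, block_prod A x -> grad f x = \mxrow_i g i (submxrow x i).

End Blocks.

(* R^m x R^n x R^r is identified with R^(m + n + r). *)
Section Triples.
Variables (R : realType) (m n r : nat).

Definition triple (x : 'rV[R]_m) (y : 'rV[R]_n) (z : 'rV[R]_r) :
  'rV[R]_(m + n + r) := row_mx (row_mx x y) z.

Definition prod3 (A : set 'rV[R]_m) (B : set 'rV[R]_n) (C : set 'rV[R]_r) :
    set 'rV[R]_(m + n + r) :=
  [set w | exists x y z, [/\ A x, B y, C z & w = triple x y z]].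

End Triples.

Section Subdifferential.
Variables (R : realType) (d : nat).
Implicit Types (f : 'rV[R]_d -> \bar R) (u v : 'rV[R]_d).
Local Open Scope ereal_scope.

Definition iota_set (C : set 'rV[R]_d) : 'rV[R]_d -> \bar R :=
  fun u => if u \in C then 0 else +oo.

Definition dom f : set 'rV[R]_d := [set u | f u < +oo].

Definition proper f : Prop := (forall u, f u != -oo) /\ dom f !=set0.

Definition regular_subdiff f u : set 'rV[R]_d :=
  [set v | dom f u /\
     0 <= limf_einf (fun w => (f w - f u - (dotv v (w - u))%:E)
                                * ((norm2 (w - u))^-1)%:E) (u^')].

Definition limiting_subdiff f u : set 'rV[R]_d :=
  [set v | dom f u /\ exists (us vs : nat -> 'rV[R]_d),
     [/\ us k @[k --> \oo] --> u,
         f (us k) @[k --> \oo] --> f u,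
         vs k @[k --> \oo] --> v &
         forall k, regular_subdiff f (us k) (vs k)]].

Definition dom_subdiff f : set 'rV[R]_d :=
  [set u | limiting_subdiff f u !=set0].

(* [ereal_inf set0 = +oo] *)
Definition dist0 (A : set 'rV[R]_d) : \bar R :=
  ereal_inf [set (norm2 v)%:E | v in A].

Definition desingularizing (eta : \bar R) (phi : R -> R) : Prop :=
  [/\ phi 0%R = 0%R,
      {within [set s : R | 0 <= s%:E < eta], continuous phi},
      (forall s : R, 0 <= s%:E < eta -> (0 <= phi s)%R) &
      forall s : R, 0 < s%:E < eta ->
        [/\ derivable phi s 1%R, {for s, continuous (derive1 phi)} &
            (0 < derive1 phi s)%R]].

Definition KL_at f (ubar : 'rV[R]_d) : Prop :=
  exists (eta : \bar R) (U : set 'rV[R]_d) (phi : R -> R),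
    [/\ 0 < eta, nbhs ubar U, desingularizing eta phi &
        forall u, U u -> f ubar < f u < f ubar + eta ->
          1 <= (derive1 phi (fine (f u - f ubar)))%:E
                 * dist0 (limiting_subdiff f u)].

Definition KL_function f : Prop :=
  [/\ proper f, lower_semicontinuous f &
      forall ubar, dom_subdiff f ubar -> KL_at f ubar].

End Subdifferential.

Section Algorithm.
Variables (R : realType) (P Q : nat) (p : 'I_P -> nat) (q : 'I_Q -> nat)
  (r : nat).
Notation Rp := 'rV[R]_(\sum_i p i).
Notation Rq := 'rV[R]_(\sum_j q j).
Notation Rr := 'rV[R]_r.
Variables (X : forall i, set 'rV[R]_(p i)) (Y : forall j, set 'rV[R]_(q j))
  (Z : set Rr) (F : 'rV[R]_(\sum_i p i + \sum_j q j + r) -> R).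

Definition Psi (w : 'rV[R]_(\sum_i p i + \sum_j q j + r)) : \bar R :=
  ((F w)%:E + iota_set (block_prod X) (lsubmx (lsubmx w))
    + iota_set (block_prod Y) (rsubmx (lsubmx w)) + iota_set Z (rsubmx w))%E.

Definition x_step (i : 'I_P) (alphak : R) (x : Rp) (y : Rq) (z : Rr) :
    set 'rV[R]_(p i) :=
  argmin (@X i) (fun u =>
    dotv (u - submxrow x i) (block_grad (fun x' => F (triple x' y z)) i x)
    + alphak / 2 * norm2 (u - submxrow x i) ^+ 2).

Definition y_step (j : 'I_Q) (betak : R) (x : Rp) (y : Rq) (z : Rr) :
    set 'rV[R]_(q j) :=
  argmin (@Y j) (fun u =>
    dotv (u - submxrow y j) (block_grad (fun y' => F (triple x y' z)) j y)
    + betak / 2 * norm2 (u - submxrow y j) ^+ 2).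

Definition z_step (gamma : R) (x : Rp) (y : Rq) (z : Rr) : set Rr :=
  argmin Z (fun u => F (triple x y u) + gamma / 2 * norm2 (u - z) ^+ 2).

Definition generated_by_algorithm
    (Lx : 'I_P -> Rq -> Rr -> R) (Ly : 'I_Q -> Rp -> Rr -> R)
    (etax : 'I_P -> R) (etay : 'I_Q -> R)
    (alpha : 'I_P -> R) (beta : 'I_Q -> R) (gamma : R)
    (x : nat -> Rp) (y : nat -> Rq) (z : nat -> Rr) : Prop :=
  [/\ [/\ block_prod X (x 0%N), block_prod Y (y 0%N) & Z (z 0%N)],
      (forall k i,
         @x_step i (alpha i * Num.max (Lx i (y k) (z k)) (etax i))
           (x k) (y k) (z k) (submxrow (x k.+1) i)),
      (forall k j,
         @y_step j (beta j * Num.max (Ly j (x k.+1) (z k)) (etay j))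
           (x k.+1) (y k) (z k) (submxrow (y k.+1) j)) &
      (forall k, z_step gamma (x k.+1) (y k.+1) (z k) (z k.+1))].

End Algorithm.

(* Main.v *)
(* Each iterate w_(k+1) minimizes over the product C of the constraint sets a
   surrogate G_k, the sum of the three proximal subproblems, whose gradient
   differs from that of F by at most B (|u - w_k| + |w_(k+1) - w_k|); separability
   and the descent lemma give F w_(k+1) + c |w_(k+1) - w_k|^2 <= F w_k.

   The desingularizing function phi is not assumed concave, so the usual estimate
   phi a - phi b >= phi' a (a - b) is not available. Instead, the KL inequality
   yields, between the levels F w_(k+1) and F w_(k+2), a chain of points of C
   starting at w_(k+1), of length at most
   t = 2 (phi (F w_(k+1) - l) - phi (F w_(k+2) - l)), where l is the limit of F w_k.
   Along the chain F - G_k changes at rate at most B (t + 2 |w_(k+1) - w_k|), while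
   G_k is minimal at w_(k+1), hence
   c |w_(k+2) - w_(k+1)|^2 <= F w_(k+1) - F w_(k+2)
                           <= B (t + 2 |w_(k+1) - w_k|) t.
   Therefore |w_(k+2) - w_(k+1)| <= |w_(k+1) - w_k| / 2 + K t, and the right-hand
   sides telescope as soon as the iterates are close to a cluster point. *)

Require Import Defs.
From mathcomp Require Import all_boot all_order all_algebra.
From mathcomp Require Import ring lra.
From mathcomp Require Import all_classical all_reals all_analysis.

Set Implicit Arguments.
Unset Strict Implicit.
Unset Printing Implicit Defensive.

Import Order.TTheory GRing.Theory Num.Theory.
Import numFieldNormedType.Exports.

Local Open Scope classical_set_scope.
Local Open Scope ring_scope.

(** * Euclidean norm and its comparison with the library topology *)

Section EuclideanTheory.
Variables (R : realType) (n : nat).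
Implicit Types (u v w : 'rV[R]_n) (a b : R).

Lemma dotvC u v : dotv u v = dotv v u.
Proof. by apply: eq_bigr => j _; rewrite mulrC. Qed.

Lemma dotvDl u v w : dotv (u + v) w = dotv u w + dotv v w.
Proof. by rewrite -big_split; apply: eq_bigr => j _; rewrite mxE mulrDl. Qed.

Lemma dotvZl a u v : dotv (a *: u) v = a * dotv u v.
Proof. by rewrite mulr_sumr; apply: eq_bigr => j _; rewrite mxE mulrA. Qed.

Lemma dotvNl u v : dotv (- u) v = - dotv u v.
Proof. by rewrite -scaleN1r dotvZl mulN1r. Qed.

Lemma dotvBl u v w : dotv (u - v) w = dotv u w - dotv v w.
Proof. by rewrite dotvDl dotvNl. Qed.

Lemma dotvDr u v w : dotv w (u + v) = dotv w u + dotv w v.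
Proof. by rewrite !(dotvC w) dotvDl. Qed.

Lemma dotvZr a u v : dotv u (a *: v) = a * dotv u v.
Proof. by rewrite !(dotvC u) dotvZl. Qed.

Lemma dotvBr u v w : dotv w (u - v) = dotv w u - dotv w v.
Proof. by rewrite !(dotvC w) dotvBl. Qed.

Lemma dotv0l u : dotv 0 u = 0.
Proof. by rewrite -(scale0r 0) dotvZl mul0r. Qed.

Lemma dotv0r u : dotv u 0 = 0.
Proof. by rewrite dotvC dotv0l. Qed.

Lemma dotv_ge0 u : 0 <= dotv u u.
Proof. by apply: sumr_ge0 => j _; rewrite -expr2 sqr_ge0. Qed.

Lemma norm2_ge0 u : 0 <= norm2 u.
Proof. exact: sqrtr_ge0. Qed.

Lemma sqr_norm2 u : norm2 u ^+ 2 = dotv u u.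
Proof. by rewrite sqr_sqrtr ?dotv_ge0. Qed.

Lemma norm2_0 : norm2 (0 : 'rV[R]_n) = 0.
Proof. by rewrite /norm2 dotv0l sqrtr0. Qed.

Lemma norm2Z a u : norm2 (a *: u) = `|a| * norm2 u.
Proof.
by rewrite /norm2 dotvZl dotvZr mulrA -expr2 sqrtrM ?sqr_ge0// sqrtr_sqr.
Qed.

Lemma norm2N u : norm2 (- u) = norm2 u.
Proof. by rewrite -scaleN1r norm2Z normrN1 mul1r. Qed.

Lemma norm2B u v : norm2 (u - v) = norm2 (v - u).
Proof. by rewrite -norm2N opprB. Qed.

Lemma ler_coord_norm2 u j : `|u 0 j| <= norm2 u.
Proof.
rewrite -sqrtr_sqr ler_wsqrtr// /dotv (bigD1 j)//= -expr2 lerDl.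
by apply: sumr_ge0 => i _; rewrite -expr2 sqr_ge0.
Qed.

Lemma norm2_eq0 u : norm2 u = 0 -> u = 0.
Proof.
move=> u0; apply/rowP => j; rewrite mxE; apply/eqP.
by rewrite -normr_le0 -u0 ler_coord_norm2.
Qed.

Lemma cauchy_schwarz u v : dotv u v <= norm2 u * norm2 v.
Proof.
have [u0|u0] := eqVneq (norm2 u) 0.
  by rewrite u0 mul0r (norm2_eq0 u0) dotv0l.
have [v0|v0] := eqVneq (norm2 v) 0.
  by rewrite v0 mulr0 (norm2_eq0 v0) dotv0r.
have := dotv_ge0 (norm2 v *: u - norm2 u *: v).
rewrite dotvBl !dotvBr !dotvZl !dotvZr -!sqr_norm2 (dotvC v u).
have up : 0 < norm2 u by rewrite lt0r u0 norm2_ge0.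
have vp : 0 < norm2 v by rewrite lt0r v0 norm2_ge0.
move=> h; have : 0 <= norm2 u * norm2 v * (norm2 u * norm2 v - dotv u v).
  by lra.
by rewrite pmulr_rge0 ?mulr_gt0// subr_ge0.
Qed.

Lemma abs_dotv u v : `|dotv u v| <= norm2 u * norm2 v.
Proof.
rewrite ler_norml cauchy_schwarz andbT lerNl -dotvNl -(norm2N u).
exact: cauchy_schwarz.
Qed.

Lemma ler_norm2D u v : norm2 (u + v) <= norm2 u + norm2 v.
Proof.
rewrite -(@ler_pXn2r _ 2)// ?nnegrE ?addr_ge0 ?norm2_ge0//.
rewrite sqr_norm2 dotvDl !dotvDr -!sqr_norm2 (dotvC v u).
by have := cauchy_schwarz u v; lra.
Qed.

Lemma ler_norm2B u v : norm2 (u - v) <= norm2 u + norm2 v.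
Proof. by rewrite -(norm2N v) ler_norm2D. Qed.

Lemma ler_norm2_dist w u v : norm2 (u - v) <= norm2 (u - w) + norm2 (w - v).
Proof. by rewrite -[u - v](subrKA w) ler_norm2D. Qed.

Lemma sqr_norm2D u v :
  norm2 (u + v) ^+ 2 = norm2 u ^+ 2 + 2 * dotv u v + norm2 v ^+ 2.
Proof. by rewrite !sqr_norm2 dotvDl !dotvDr (dotvC v u); ring. Qed.

Lemma ler_mx_norm_norm2 u : `|u| <= norm2 u.
Proof.
rewrite /Num.norm/= mx_normrE; apply: bigmax_le => [|[i j] _ /=].
  exact: norm2_ge0.
by rewrite ord1 ler_coord_norm2.
Qed.

Lemma ler_norm2_mx_norm u : norm2 u <= n%:R * `|u|.
Proof.
have n0 : 0 <= n%:R * `|u| by rewrite mulr_ge0.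
rewrite -(ger0_norm n0) -sqrtr_sqr ler_wsqrtr// /dotv.
have le j : u 0 j * u 0 j <= `|u| ^+ 2.
  rewrite -expr2 -real_normK ?num_real// ler_pXn2r ?nnegrE//.
  by rewrite [leRHS]/Num.norm/= mx_normrE (le_bigmax _ _ (0, j)).
apply: (le_trans (ler_sum _ (fun j _ => le j))).
rewrite sumr_const card_ord -(mulr_natl (`|u| ^+ 2)) exprMn.
rewrite ler_wpM2r ?sqr_ge0//.
by rewrite -natrX ler_nat; case: (n) => // m; rewrite leq_pmull.
Qed.

(** The max norm and [norm2] bound each other up to the factor [n]. Every topological notion is read
    through Euclidean balls by way of this equivalence. *)
Lemma nbhs_norm2P u (A : set 'rV[R]_n) :
  nbhs u A <-> exists2 d, 0 < d & forall w, norm2 (w - u) < d -> A w.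
Proof.
split=> [/nbhs_ballP[d /= d0 dA]|[d d0 dA]].
  exists d => // w wd; apply: dA; rewrite -ball_normE/= distrC.
  exact: le_lt_trans (ler_mx_norm_norm2 _) wd.
(* The summand 1 keeps the divisor positive when [n] is 0. *)
have n0 : 0 < n%:R + 1 :> R by rewrite ltr_wpDl.
apply/nbhs_ballP; exists (d / (n%:R + 1)) => /=; first by rewrite divr_gt0.
move=> w; rewrite -ball_normE/= distrC ltr_pdivlMr// => wd; apply: dA.
apply: le_lt_trans wd; apply: (le_trans (ler_norm2_mx_norm _)).
by rewrite mulrC ler_wpM2l// lerDl.
Qed.

Lemma cvg_norm2P (T : Type) (E : set_system T) {FE : Filter E}
    (f : T -> 'rV[R]_n) u :
  f @ E --> u <-> (forall e, 0 < e -> \forall t \near E, norm2 (f t - u) < e).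
Proof.
split=> [fu e e0|fu A /nbhs_norm2P[d d0 dA]].
  suff : nbhs u [set w | norm2 (w - u) < e] by move=> /fu.
  by apply/nbhs_norm2P; exists e.
have := fu d d0; apply: filterS => t; exact: dA.
Qed.

Lemma continuous_norm2P (f : 'rV[R]_n -> R) u :
  {for u, continuous f} <->
  forall e, 0 < e -> exists2 d, 0 < d &
    forall w, norm2 (w - u) < d -> `|f w - f u| < e.
Proof.
split=> [/(@cvgrPdist_lt _ _ _ _ (nbhs_filter u)) fu e /fu/nbhs_norm2P[d d0 dA]|fu].
  by exists d => // w /dA; rewrite distrC.
apply/(@cvgrPdist_lt _ _ _ _ (nbhs_filter u)) => e /fu[d d0 dA].
by apply/nbhs_norm2P; exists d => // w /dA; rewrite distrC.
Qed.

Lemma continuous_norm2_dist v : continuous (fun u => norm2 (u - v)).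
Proof.
move=> u; apply/continuous_norm2P => e e0; exists e => // w wu.
apply: le_lt_trans wu; rewrite ler_norml; apply/andP; split.
  by have := ler_norm2_dist w u v; rewrite (norm2B u w); lra.
by have := ler_norm2_dist u w v; lra.
Qed.

Lemma bounded_norm2P (A : set 'rV[R]_n) :
  bounded_set A <-> exists M, forall u, A u -> norm2 u <= M.
Proof.
split=> [[M [_ MA]]|[M MA]].
  exists (n%:R * (M + 1)) => u Au; apply: (le_trans (ler_norm2_mx_norm _)).
  by rewrite ler_wpM2l// MA// ltrDl.
exists M; split; first exact: num_real.
move=> x Mx u /MA uM; apply: (le_trans (ler_mx_norm_norm2 _)).
exact: le_trans uM (ltW Mx).
Qed.

Lemma argmin_compact (K : set 'rV[R]_n) (h : 'rV[R]_n -> R) M :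
  K !=set0 -> closed K -> (forall u, K u -> norm2 u <= M) ->
  (forall u, K u -> {for u, continuous h}) -> exists u, argmin K h u.
Proof.
move=> K0 Kc KM hc.
have [||u uK hu] := @EVT_min_rV _ _ h K K0.
- by apply: bounded_closed_compact => //; apply/bounded_norm2P; exists M.
- by apply: continuous_in_subspaceT => u; rewrite inE => /hc.
- by exists u; split; [rewrite inE in uK|move=> v Kv; apply: hu; rewrite inE].
Qed.

(** A limit point already lies in [K], where [h] is continuous, so a negative value there would
    persist nearby. Continuity is asked only on [K], which allows sets to be cut out by successive
    inequalities, each making the next function continuous. *)
Lemma closedI_ge0 (K : set 'rV[R]_n) (h : 'rV[R]_n -> R) :
  closed K -> (forall u, K u -> {for u, continuous h}) ->
  closed (K `&` [set u | 0 <= h u]).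
Proof.
move=> Kc hc u Khu; have Ku : K u.
  by apply: Kc; apply: closure_subset Khu; exact: subIsetl.
split=> //=; rewrite leNgt; apply/negP => hu0.
have /continuous_norm2P/(_ (- h u)) := hc _ Ku.
rewrite oppr_gt0 => /(_ hu0)[d d0 hd].
have /Khu[w [[_ /= hw] /hd]] : nbhs u [set w | norm2 (w - u) < d].
  by apply/nbhs_norm2P; exists d.
by rewrite ltr_norml => /andP[_]; lra.
Qed.

End EuclideanTheory.

(** * First-order calculus: gradients, regular normals and subgradients *)

Section FirstOrder.
Variables (R : realType) (n : nat).
Implicit Types (u v w g : 'rV[R]_n) (f h : 'rV[R]_n -> R) (C : set 'rV[R]_n).

Definition has_grad f u g : Prop := forall e, 0 < e -> exists2 d, 0 < d &
  forall w, norm2 (w - u) < d ->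
    `|f w - f u - dotv g (w - u)| <= e * norm2 (w - u).

(** For [u] in [C] this is the Fréchet normal cone, that is, the regular subdifferential of the
    indicator, freed from extended reals. *)
Definition regular_normal C u g : Prop := forall e, 0 < e -> exists2 d, 0 < d &
  forall w, C w -> norm2 (w - u) < d -> dotv g (w - u) <= e * norm2 (w - u).

Lemma has_grad_cst (c : R) u : has_grad (fun=> c) u 0.
Proof.
move=> e e0; exists 1 => // w _.
by rewrite dotv0l subrr subr0 normr0 mulr_ge0 ?norm2_ge0// ltW.
Qed.

Lemma has_gradD f h u g g' : has_grad f u g -> has_grad h u g' ->
  has_grad (fun w => f w + h w) u (g + g').
Proof.
move=> fg hg e e0; have e2 : 0 < e / 2 by rewrite divr_gt0.
have [d d0 fd] := fg _ e2; have [d' d'0 hd] := hg _ e2.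
exists (Num.min d d'); first by rewrite lt_min d0.
move=> w; rewrite lt_min => /andP[/fd {}fd /hd {}hd]; rewrite dotvDl.
rewrite (_ : _ - _ - _ = (f w - f u - dotv g (w - u)) +
  (h w - h u - dotv g' (w - u))); last by ring.
by apply: (le_trans (ler_normD _ _)); lra.
Qed.

Lemma has_gradN f u g : has_grad f u g -> has_grad (fun w => - f w) u (- g).
Proof.
move=> fg e /fg[d d0 fd]; exists d => // w /fd; rewrite dotvNl.
by rewrite -normrN !opprD !opprK.
Qed.

Lemma has_gradB f h u g g' : has_grad f u g -> has_grad h u g' ->
  has_grad (fun w => f w - h w) u (g - g').
Proof. by move=> fg /has_gradN; exact: has_gradD. Qed.

(** The function is quadratic: the first-order remainder is exactly [c / 2 * norm2 (w - u) ^+ 2]. *)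
Lemma has_grad_prox (c : R) a g u :
  has_grad (fun w => dotv (w - a) g + c / 2 * norm2 (w - a) ^+ 2) u
    (g + c *: (u - a)).
Proof.
move=> e e0; have c1 : 0 < `|c| / 2 + 1 by rewrite ltr_wpDl.
exists (e / (`|c| / 2 + 1)); first by rewrite divr_gt0.
move=> w; rewrite ltr_pdivlMr// => /ltW wd.
have -> : w - a = (u - a) + (w - u) by rewrite [RHS]addrC subrKA.
rewrite (sqr_norm2D (u - a)) (dotvDl (u - a)) (dotvDl g) dotvZl (dotvC g).
rewrite (_ : _ - _ - _ = c / 2 * norm2 (w - u) ^+ 2); last by field.
rewrite normrM normrX (ger0_norm (norm2_ge0 _)) expr2 mulrA.
rewrite ler_wpM2r ?norm2_ge0// normrM normfV (ger0_norm (ler0n R 2)).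
by apply: le_trans wd; rewrite mulrC ler_wpM2l ?norm2_ge0// lerDl.
Qed.

Lemma has_grad_local_lipschitz f u g e : has_grad f u g -> 0 < e ->
  exists2 d, 0 < d & forall w, norm2 (w - u) < d ->
    `|f w - f u| <= (norm2 g + e) * norm2 (w - u).
Proof.
move=> fg /fg[d d0 fd]; exists d => // w /fd wd.
rewrite -(subrK (dotv g (w - u)) (f w - f u)) (le_trans (ler_normD _ _))//.
by rewrite mulrDl addrC lerD// abs_dotv.
Qed.

Lemma has_grad_continuous f u g : has_grad f u g -> {for u, continuous f}.
Proof.
move=> /has_grad_local_lipschitz/(_ ltr01)[d d0 fd].
apply/continuous_norm2P => e e0.
have g1 : 0 < norm2 g + 1 by rewrite ltr_wpDl ?norm2_ge0.
exists (Num.min d (e / (norm2 g + 1))); first by rewrite lt_min d0 divr_gt0.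
move=> w; rewrite lt_min ltr_pdivlMr// => /andP[/fd wd we].
by apply: le_lt_trans wd _; rewrite mulrC.
Qed.

Lemma derivable_expansion (psi : R -> R) b : derivable psi b 1 ->
  forall e, 0 < e -> exists2 d, 0 < d & forall s, `|s - b| < d ->
    `|psi s - psi b - derive1 psi b * (s - b)| <= e * `|s - b|.
Proof.
move=> dpsi e e0; have := dpsi; rewrite /derivable => /cvg_ex[l hl].
have lE : derive1 psi b = l by rewrite derive1E; apply: cvg_lim hl.
move/cvgrPdist_le : hl => /(_ _ e0); rewrite near_withinE.
move=> /nbhs_ballP[d /= d0 hd]; exists d => // s sb.
have [->|s0] := eqVneq s b; first by rewrite !subrr mulr0 subrr normr0 mulr0.
have sb0 : s - b != 0 by rewrite subr_eq0.
have := hd (s - b); rewrite -ball_normE/= add0r normrN => /(_ sb sb0).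
rewrite lE /GRing.scale/= mulr1 subrK => hs.
rewrite -ler_pdivrMr ?normr_gt0// -normfV -normrM -normrN.
suff -> : - ((psi s - psi b - l * (s - b)) / (s - b)) =
  l - (s - b)^-1 * (psi s - psi b) by [].
by field.
Qed.

Lemma has_grad_comp (psi : R -> R) f u g : derivable psi (f u) 1 ->
  has_grad f u g -> has_grad (psi \o f) u (derive1 psi (f u) *: g).
Proof.
move=> dpsi fg e e0.
have g1 : 0 < norm2 g + 1 by rewrite ltr_wpDl ?norm2_ge0.
have e2 : 0 < e / 2 by rewrite divr_gt0.
set p := derive1 psi (f u); have p1 : 0 < `|p| + 1 by rewrite ltr_wpDl.
(* Half of the error comes from the remainder of [psi], multiplied by the local Lipschitz constant
   [norm2 g + 1] of [f]; the other half is the remainder of [f] multiplied by [p]. *)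
have [|d d0 psid] := @derivable_expansion _ _ dpsi (e / 2 / (norm2 g + 1)).
  by rewrite !divr_gt0.
have [|d1 d10 fd1] := fg (e / 2 / (`|p| + 1)); first by rewrite !divr_gt0.
have [d2 d20 fd2] := has_grad_local_lipschitz fg ltr01.
exists (Num.min (Num.min d1 d2) (d / (norm2 g + 1))).
  by rewrite !lt_min d10 d20 divr_gt0.
move=> w; rewrite !lt_min ltr_pdivlMr// => /andP[/andP[/fd1 w1 /fd2 w2] wd].
have wu0 := norm2_ge0 (w - u).
have /psid {}psid : `|f w - f u| < d by apply: le_lt_trans w2 _; rewrite mulrC.
rewrite dotvZl -/p in psid *.
rewrite (_ : _ - _ - _ = (psi (f w) - psi (f u) - p * (f w - f u)) +
  p * (f w - f u - dotv g (w - u))); last by rewrite /=; ring.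
apply: (le_trans (ler_normD _ _)); rewrite normrM [e]splitr mulrDl.
apply: lerD.
  apply: (le_trans psid); rewrite -[leLHS]mulrA ler_wpM2l ?(ltW e2)//.
  by rewrite ler_pdivrMl.
apply: (@le_trans _ _ (`|p| * (e / 2 / (`|p| + 1) * norm2 (w - u)))).
  by rewrite ler_wpM2l.
have -> : `|p| * (e / 2 / (`|p| + 1) * norm2 (w - u)) =
  (e / 2 * norm2 (w - u)) * (`|p| / (`|p| + 1)) by ring.
apply: ler_piMr; first by rewrite mulr_ge0 ?(ltW e2).
by rewrite ler_pdivrMr// mul1r lerDl ler01.
Qed.

Lemma differentiable_has_grad f u : differentiable f u ->
  has_grad f u (grad f u).
Proof.
move=> df e e0.
have dE v : 'd f u v = dotv (grad f u) v.
  rewrite {1}(row_sum_delta v) linear_sum; apply: eq_bigr => j _.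
  by rewrite linearZ/= mxE deriveE// mulrC.
have := diff_locally df => /eqaddoP/(_ _ e0)/nbhs_ballP[d /= d0 hd].
exists d => // w wd.
have := hd (w - u); rewrite -ball_normE/= add0r normrN.
move=> /(_ (le_lt_trans (ler_mx_norm_norm2 _) wd)).
rewrite !fctE /= subrK dE opprD addrA => /le_trans; apply.
by apply: ler_wpM2l; [exact: ltW|exact: ler_mx_norm_norm2].
Qed.

Lemma regular_normalZ C u g c : 0 <= c -> regular_normal C u g ->
  regular_normal C u (c *: g).
Proof.
move=> c0 Cg e e0; have c1 : 0 < c + 1 by rewrite ltr_wpDl.
have [|d d0 hd] := Cg (e / (c + 1)); first by rewrite divr_gt0.
exists d => // w Cw /(hd _ Cw) wd; rewrite dotvZl.
apply: (le_trans (ler_wpM2l c0 wd)); rewrite mulrA ler_wpM2r ?norm2_ge0//.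
by rewrite mulrCA ler_piMr ?ltW// ltr_pdivrMr// mul1r ltrDl.
Qed.

(** Fermat's rule under a constraint: on [C] near [u] the increment [f w - f u] is nonnegative and
    equals [dotv g (w - u)] up to a small remainder. *)
Lemma local_min_regular_normal C f u g d : 0 < d -> has_grad f u g ->
  (forall w, C w -> norm2 (w - u) < d -> f u <= f w) ->
  regular_normal C u (- g).
Proof.
move=> d0 fg fmin e /fg[d' d'0 fd].
exists (Num.min d d') => [|w Cw]; first by rewrite lt_min d0.
rewrite lt_min => /andP[/(fmin _ Cw) fw /fd]; rewrite dotvNl.
by rewrite ler_norml => /andP[]; lra.
Qed.

Local Open Scope ereal_scope.

(** Easy half of the sum rule: on [C] the difference quotient is bounded below by the two
    remainders, and off [C] it is infinite. *)
Lemma smooth_plus_indicator_regular_subdiff (F : 'rV[R]_n -> \bar R) C f u g v :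
  (forall w, F w = if w \in C then (f w)%:E else +oo) -> C u ->
  has_grad f u g -> regular_normal C u v -> regular_subdiff F u (g + v)%R.
Proof.
move=> FE Cu fg Cv; have Fu : F u = (f u)%:E by rewrite FE mem_set.
split; first by rewrite /dom/= Fu ltry.
rewrite limf_einfE; apply/lee_subgt0Pr => e e0.
have e2 : (0 < e / 2)%R by rewrite divr_gt0.
have [d d0 fd] := fg _ e2; have [d' d'0 vd] := Cv _ e2.
(* The lower limit is a supremum of infima over punctured neighborhoods, so a single one with
   infimum at least [- e] suffices. *)
pose V := [set w | (norm2 (w - u) < Num.min d d')%R /\ w != u].
apply: (@le_trans _ _ (ereal_inf [set (F w - F u - (dotv (g + v) (w - u))%:E) *
    ((norm2 (w - u))^-1)%:E | w in V])); last first.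
  apply: ereal_sup_ubound; exists V => //; rewrite /dnbhs /within /=.
  by apply/nbhs_norm2P; exists (Num.min d d'); rewrite ?lt_min ?d0.
rewrite sub0e; apply: le_ereal_inf_tmp => _ [w [wd wu] <-].
have wu0 : (0 < norm2 (w - u))%R.
  rewrite lt0r norm2_ge0 andbT; apply/eqP => /norm2_eq0/eqP.
  by rewrite subr_eq0 (negbTE wu).
rewrite FE Fu; case: ifPn => [/set_mem Cw|_]; last first.
  by rewrite addye// gt0_mulye ?leNye ?leey ?lte_fin ?invr_gt0.
move: wd; rewrite lt_min => /andP[/fd + /(vd _ Cw)].
rewrite -!EFinB -EFinM lee_fin ler_pdivlMr// dotvDl ler_norml => /andP[].
by lra.
Qed.

Lemma regular_limiting_subdiff (F : 'rV[R]_n -> \bar R) u v :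
  regular_subdiff F u v -> limiting_subdiff F u v.
Proof.
move=> Fuv; split; first by case: Fuv.
by exists (fun=> u), (fun=> v); split => //; exact: cvg_cst.
Qed.

Lemma limiting_subdiff_iota C (us vs : nat -> 'rV[R]_n) u v : C u ->
  (forall k, C (us k)) -> us k @[k --> \oo] --> u -> vs k @[k --> \oo] --> v ->
  (forall k, regular_normal C (us k) (vs k)) ->
  limiting_subdiff (iota_set C) u v.
Proof.
move=> Cu Cus usu vsv Cn; split; first by rewrite /dom/= /iota_set mem_set.
exists us, vs; split=> //.
  rewrite /iota_set mem_set//; under eq_fun => k do rewrite mem_set//.
  exact: cvg_cst.
move=> k; rewrite -[vs k]add0r.
apply: (@smooth_plus_indicator_regular_subdiff _ C (fun=> 0%R)) => //.
exact: has_grad_cst.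
Qed.

End FirstOrder.

(* A desingularizing function on [0, eta) extended to the left so as to become
   continuous at 0. *)
Definition total_desingularizing (R : realType) (eta : R) (psi : R -> R) :=
  [/\ psi 0 = 0, forall s, s < eta -> {for s, continuous psi},
      forall s, 0 < s < eta -> derivable psi s 1 /\ 0 < derive1 psi s &
      forall s t, 0 <= s -> s < t -> t < eta -> psi s < psi t].

Lemma desingularizing_total (R : realType) (eta : \bar R) (phi : R -> R) :
  (0 < eta)%E -> desingularizing eta phi ->
  exists eta' psi, [/\ 0 < eta', (eta'%:E <= eta)%E,
    total_desingularizing eta' psi &
    forall s, 0 < s -> derive1 psi s = derive1 phi s].
Proof.
move=> eta0 [phi0 phic _ phid].
(* An infinite [eta] is replaced by 1, which only shrinks the range of levels concerned. *)
have [eta' eta'0 eta'E] : exists2 e : R, 0 < e & (e%:E <= eta)%E.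
  case: eta eta0 {phic phid} => [e e0| _|//]; last by exists 1; rewrite ?leey.
  by exists e.
(* To the left of 0 the extension is constant, equal to [phi 0 = 0]. *)
pose psi (s : R) : R := phi (Num.max s 0); exists eta', psi.
have max0 (s : R) : 0 <= s -> Num.max s 0 = s by move=> s0; rewrite max_l.
have near_psi (s : R) : 0 < s -> \forall t \near s, phi t = psi t.
  move=> s0; apply: filterS (lt_nbhsr s0) => t t0.
  by rewrite /psi max0// ltW.
have dpsi (s : R) : 0 < s -> derive1 psi s = derive1 phi s.
  by move=> /near_psi h; rewrite !derive1E (near_eq_derive _ h).
have lt_eta (s : R) : s < eta' -> (s%:E < eta)%E.
  by move=> se; apply: lt_le_trans eta'E; rewrite lte_fin.
have psic (s : R) : s < eta' -> {for s, continuous psi}.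
  move=> se; apply/(@cvgrPdist_lt _ _ _ _ (nbhs_filter s)) => e e0.
  have ms (t : R) : t < eta' -> [set s : R | (0 <= s%:E < eta)%E] (Num.max t 0).
    by move=> te; rewrite /= lee_fin le_max lexx orbT/= lt_eta// gt_max te.
  move/subspace_continuousP : phic => /(_ _ (ms _ se))/cvgrPdist_lt/(_ e e0).
  rewrite near_withinE => /nbhs_ballP[d /= d0 hd].
  apply/nbhs_ballP; exists (Num.min d (eta' - s)).
    by rewrite /= lt_min d0 subr_gt0.
  move=> t; rewrite -ball_normE/= lt_min => /andP[td te].
  have te' : t < eta'.
    by move: te; rewrite distrC => /(le_lt_trans (ler_norm _)); lra.
  apply: hd (ms _ te'); rewrite -ball_normE/=; apply: le_lt_trans td.
  have := ler_norm (s - t); have := ler_norm (t - s); rewrite distrC ler_norml.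
  by case: (leP s 0); case: (leP t 0) => *; apply/andP; split; lra.
have dpsi_gt0 (s : R) : 0 < s < eta' -> derivable psi s 1 /\ 0 < derive1 psi s.
  move=> /andP[s0 se]; have [|dphi _ phi'] := phid s; first by rewrite lte_fin s0 lt_eta.
  by rewrite dpsi//; split=> //; exact: near_eq_derivable (near_psi _ s0) dphi.
split => //; split=> //; first by rewrite /psi max0.
move=> s t s0 st te; apply: (@gtr0_derive1_lt_cc _ psi s t) => //.
- move=> x; rewrite in_itv/= => /andP[sx xt].
  by apply: (dpsi_gt0 x _).1; rewrite (le_lt_trans s0 sx) (lt_trans xt te).
- move=> x; rewrite in_itv/= => /andP[sx xt].
  by apply: (dpsi_gt0 x _).2; rewrite (le_lt_trans s0 sx) (lt_trans xt te).
- apply: continuous_in_subspaceT => x; rewrite inE/= in_itv/= => /andP[_ xt].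
  by apply: psic; exact: le_lt_trans xt te.
- by rewrite in_itv/= lexx ltW.
- by rewrite in_itv/= lexx ltW.
Qed.

(** * Descent from the KL inequality *)

Section KurdykaLojasiewicz.
Variables (R : realType) (n : nat) (C : set 'rV[R]_n) (F : 'rV[R]_n -> R)
  (gF : 'rV[R]_n -> 'rV[R]_n).
Hypotheses (C_closed : closed C) (F_grad : forall u, C u -> has_grad F u (gF u)).
Implicit Types (u v w : 'rV[R]_n) (eta r tau : R) (psi : R -> R).

(** The form in which the KL property is used: real-valued, and tested only on the subgradients
    [gF u + v] given by the sum rule. *)
Definition smooth_KL_at wbar eta r psi := [/\ 0 < eta, 0 < r,
  total_desingularizing eta psi &
  forall u v, C u -> norm2 (u - wbar) < r -> 0 < F u - F wbar < eta ->
    regular_normal C u v -> 1 <= derive1 psi (F u - F wbar) * norm2 (gF u + v)].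

Lemma KL_at_smooth (Psi : 'rV[R]_n -> \bar R) wbar :
  (forall w, Psi w = if w \in C then (F w)%:E else +oo%E) -> C wbar ->
  KL_at Psi wbar -> exists eta r psi, smooth_KL_at wbar eta r psi.
Proof.
move=> PsiE Cw [eta0 [U [phi [eta0_gt0 /nbhs_norm2P[r r0 Ur] phiP KL]]]].
have [eta [psi [eta_gt0 etaE psiP dpsi]]] := desingularizing_total eta0_gt0 phiP.
exists eta, r, psi; split=> // u v Cu ur /andP[Fu0 Fue] uv.
have PsiF w : C w -> Psi w = (F w)%:E by move=> Cw'; rewrite PsiE mem_set.
have := KL u (Ur _ ur); rewrite !PsiF// lte_fin -subr_gt0 Fu0/=.
have -> : ((F u)%:E < (F wbar)%:E + eta0)%E.
  apply: (@lt_le_trans _ _ ((F wbar)%:E + eta%:E)%E).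
    by rewrite -EFinD lte_fin; lra.
  by rewrite leeD2l.
move=> /(_ isT); rewrite dpsi// => /le_trans; rewrite -lee_fin; apply.
have phi_ge0 : 0 <= derive1 phi (F u - F wbar).
  have [_ _ psi_gt0 _] := psiP; rewrite -dpsi//; apply: ltW.
  by apply: (psi_gt0 _ _).2; rewrite Fu0.
(* The distance to the subdifferential is an infimum, hence at most the norm of the particular
   subgradient [gF u + v]. *)
rewrite EFinM lee_wpmul2l ?lee_fin//; apply: ereal_inf_lbound.
exists (gF u + v) => //; apply: regular_limiting_subdiff.
exact: (smooth_plus_indicator_regular_subdiff PsiE Cu (F_grad Cu) uv).
Qed.

(* Minimizing psi (F - F wbar) + |. - u|^2 / (2 tau) over the ball of radius
   tau: an interior minimizer would be a point with a subgradient too small for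
   the KL inequality. *)
Lemma KL_descent wbar eta r psi u tau0 : smooth_KL_at wbar eta r psi ->
  C u -> norm2 (u - wbar) < r -> 0 < F u - F wbar < eta -> 0 < tau0 ->
  exists tau u', [/\ 0 < tau < tau0, C u', norm2 (u' - u) = tau &
    psi (F u' - F wbar) <= psi (F u - F wbar) - tau / 2].
Proof.
move=> [eta0 r0 [psi0 psic dpsi psi_lt] KL] Cu ur /andP[Fu0 Fue] tau0_gt0.
have /continuous_norm2P Fc := has_grad_continuous (F_grad Cu).
have [|d d0 Fd] := Fc (Num.min (F u - F wbar) (eta - (F u - F wbar))).
  by rewrite lt_min Fu0 subr_gt0.
(* On the ball of radius [tau] the gap stays in the interval where [psi] is differentiable, and the
   ball lies in the region where the KL inequality holds. The halves make the three inequalities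
   strict. *)
pose tau := Num.min (d / 2) (Num.min (tau0 / 2) ((r - norm2 (u - wbar)) / 2)).
have tau_gt0 : 0 < tau by rewrite !lt_min !divr_gt0// subr_gt0.
have [tau_d tau_tau0 tau_r] : [/\ tau < d, tau < tau0 & tau < r - norm2 (u - wbar)].
  have ltd2 (a : R) : 0 < a -> a / 2 < a by move=> a0; lra.
  rewrite /tau; split.
  - by rewrite !gt_min ltd2.
  - by rewrite !gt_min ltd2// orbT.
  - by rewrite !gt_min ltd2 ?orbT// subr_gt0.
pose K := C `&` [set w | 0 <= tau - norm2 (w - u)].
have Kc : closed K.
  apply: closedI_ge0 => // w _.
  by apply: continuousB; [exact: cst_continuous|exact: continuous_norm2_dist].
have KF w : K w -> 0 < F w - F wbar < eta.
  move=> [_ /=]; rewrite subr_ge0 => wu.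
  have := Fd _ (le_lt_trans wu tau_d); rewrite lt_min !ltr_norml.
  by move=> /andP[/andP[? ?] /andP[? ?]]; apply/andP; split; lra.
(* The zero linear term gives the penalty the shape of [has_grad_prox]. *)
pose h w := psi (F w - F wbar) +
  (dotv (w - u) 0 + tau^-1 / 2 * norm2 (w - u) ^+ 2).
have hgrad w : K w -> has_grad h w
    (derive1 psi (F w - F wbar) *: gF w + tau^-1 *: (w - u)).
  move=> Kw; apply: has_gradD.
    apply: (@has_grad_comp _ _ psi (fun w => F w - F wbar)).
      exact: (dpsi _ (KF _ Kw)).1.
    rewrite -[gF w]subr0; apply: has_gradB; first by apply: F_grad; case: Kw.
    exact: has_grad_cst.
  by rewrite -[_ *: _]add0r; exact: has_grad_prox.
have [|||u' [Ku' u'min]] := @argmin_compact _ _ K h (tau + norm2 u) _ Kc.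
- by exists u; split => //=; rewrite subrr norm2_0 subr0 ltW.
- move=> w [_ /=]; rewrite subr_ge0 => wu; have := ler_norm2D (w - u) u.
  by rewrite subrK; lra.
- by move=> w /hgrad; exact: has_grad_continuous.
have Cu' : C u' by case: Ku'.
have : norm2 (u' - u) <= tau by case: Ku' => _ /=; rewrite subr_ge0.
(* On the sphere the penalty equals [tau / 2], and comparison with the value of [h] at [u] gives the
   decrease. *)
rewrite le_eqVlt => /predU1P[u'tau|u'tau].
  exists tau, u'; split; rewrite ?tau_gt0//.
  have := u'min u; rewrite /h u'tau subrr norm2_0 expr0n/= mulr0 !dotv0r !addr0.
  have -> : 0 + tau^-1 / 2 * tau ^+ 2 = tau / 2 by field; exact: lt0r_neq0.
  have Ku : K u by split => //=; rewrite subrr norm2_0 subr0 ltW.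
  by move=> /(_ Ku); lra.
(* At an interior minimizer, Fermat's rule divided by [p] yields a subgradient of norm
   [norm2 (u' - u) / (p * tau)]. Multiplied by [p] this is less than 1, against the KL
   inequality. *)
have dpsi_gt0 := (dpsi _ (KF _ Ku')).2.
set p := derive1 psi _ in dpsi_gt0; have pV0 : 0 <= p^-1 by rewrite invr_ge0 ltW.
have : regular_normal C u' (- (p *: gF u' + tau^-1 *: (u' - u))).
  apply: (local_min_regular_normal (d := tau - norm2 (u' - u)) _ (hgrad _ Ku')).
    by rewrite subr_gt0.
  move=> w Cw wu'; apply: u'min; split => //=.
  by have := ler_norm2_dist u' w u; lra.
move=> /(regular_normalZ pV0).
rewrite scalerN scalerDr scalerA mulVf ?lt0r_neq0// scale1r opprD => u'normal.
have u'r : norm2 (u' - wbar) < r by have := ler_norm2_dist u u' wbar; lra.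
exfalso; have := KL _ _ Cu' u'r (KF _ Ku') u'normal; rewrite leNgt => /negP; apply.
rewrite -/p addrA subrr sub0r norm2N !norm2Z (ger0_norm pV0) mulVKf ?lt0r_neq0//.
by rewrite ger0_norm ?invr_ge0 ?ltW// ltr_pdivrMl// mulr1.
Qed.

End KurdykaLojasiewicz.

(** * Length of descent between two levels *)

Section DescentLength.
Variables (R : realType) (n : nat) (C : set 'rV[R]_n) (F : 'rV[R]_n -> R)
  (gF : 'rV[R]_n -> 'rV[R]_n).
Hypotheses (C_closed : closed C) (F_grad : forall u, C u -> has_grad F u (gF u)).
Implicit Types (u v w : 'rV[R]_n) (eta r tau : R) (psi : R -> R).

(* Concatenating KL descents from w down to the level b gives a point u with
   |u - w| <= t and |D u - D w| <= (B (t + c) + e) t. The chain is replaced by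
   minimizing F over all the points u that satisfy these bounds. *)
Lemma KL_level_gap wbar eta r psi w b (D : 'rV[R]_n -> R) gD B c :
  smooth_KL_at C F gF wbar eta r psi ->
  C w -> F wbar <= b -> b <= F w -> F w - F wbar < eta ->
  let t := 2 * (psi (F w - F wbar) - psi (b - F wbar)) in
  norm2 (w - wbar) + t < r -> 0 <= B -> 0 <= c ->
  (forall u, C u -> norm2 (u - wbar) < r ->
     has_grad D u (gD u) /\ norm2 (gD u) <= B * (norm2 (u - w) + c)) ->
  (forall u, C u -> F w - D w <= F u - D u) ->
  F w - b <= B * (t + c) * t.
Proof.
move=> KL Cw wbarb bw weta t wr B0 c0 DP FDmin.
have [eta0 r0 [psi0 psic dpsi psi_lt] _] := KL.
have psi_le s s' : 0 <= s -> s <= s' -> s' < eta -> psi s <= psi s'.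
  move=> s0; rewrite le_eqVlt => /predU1P[->//|ss'] s'e.
  exact/ltW/psi_lt.
have t0 : 0 <= t by rewrite mulr_ge0// subr_ge0 psi_le; lra.
(* The slack [e] pays for the first-order remainder of [D] in each small step; it is let go to 0
   here. *)
suff gap e (e0 : 0 < e) : F w - b <= (B * (t + c) + e) * t.
  apply/ler_addgt0Pr => e e0; have t1 : 0 < t + 1 by rewrite ltr_wpDl.
  have e't : 0 < e / (t + 1) by rewrite divr_gt0.
  apply: (le_trans (gap _ e't)).
  rewrite mulrDl lerD2l -mulrA ler_piMr ?ltW//.
  by rewrite mulrC ltr_pdivrMr// mul1r ltrDl.
(* [T u] is the length allowed on the way down from [w] to the level of [u]: a KL descent of length
   [tau] lowers [psi] by at least [tau / 2], hence raises [T] by at least [tau]. *)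
pose T u := 2 * (psi (F w - F wbar) - psi (F u - F wbar)).
(* The constraints are nested so that each function is continuous on the preceding set: [K1] stays
   in the ball where [D] has a gradient, and [F u <= F w] in [K3] keeps the argument of [psi] below
   [eta]. *)
pose K1 := C `&` [set u | 0 <= t - norm2 (u - w)].
pose K2 := K1 `&` [set u | 0 <= F u - b].
pose K3 := K2 `&` [set u | 0 <= F w - F u].
pose K4 := K3 `&` [set u | 0 <= T u - norm2 (u - w)].
pose K := K4 `&` [set u | 0 <= (B * (T u + c) + e) * T u + (D u - D w)].
have FC u : C u -> {for u, continuous F}.
  by move=> Cu; exact: has_grad_continuous (F_grad Cu).
have K1r u : K1 u -> norm2 (u - wbar) < r.
  by move=> [_ /=]; have := ler_norm2_dist w u wbar; lra.
have cK1 : closed K1.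
  apply: closedI_ge0 => // u _.
  by apply: continuousB; [exact: cst_continuous|exact: continuous_norm2_dist].
have cK2 : closed K2.
  apply: closedI_ge0 => // u [Cu _].
  by apply: continuousB; [exact: FC|exact: cst_continuous].
have cK3 : closed K3.
  apply: closedI_ge0 => // u [[Cu _] _].
  by apply: continuousB; [exact: cst_continuous|exact: FC].
have TC u : K3 u -> {for u, continuous T}.
  move=> [[[Cu _] _] /= Fuw]; apply: continuousM; first exact: cst_continuous.
  apply: continuousB; first exact: cst_continuous.
  apply: (@continuous_comp _ _ _ (fun u => F u - F wbar) psi).
    by apply: continuousB; [exact: FC|exact: cst_continuous].
  by apply: psic; lra.
have cK4 : closed K4.
  apply: closedI_ge0 => // u /TC Tu.
  by apply: continuousB => //; exact: continuous_norm2_dist.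
have cK : closed K.
  apply: closedI_ge0 => // u [K3u _]; have /TC Tu := K3u.
  have [[K1u _] _] := K3u; have [Cu _] := K1u.
  apply: continuousD.
    apply: continuousM => //; apply: continuousD; last exact: cst_continuous.
    apply: continuousM; first exact: cst_continuous.
    by apply: continuousD => //; exact: cst_continuous.
  apply: continuousB; last exact: cst_continuous.
  exact: has_grad_continuous (DP _ Cu (K1r _ K1u)).1.
have Kw : K w.
  have Tw : T w = 0 by rewrite /T subrr mulr0.
  by do !split; rewrite //= ?Tw ?subrr ?norm2_0 ?mulr0 ?addr0 ?subr0 ?subr_ge0.
have [|||u [Ku umin]] := @argmin_compact _ _ K F (t + norm2 w) _ cK.
- by exists w.
- move=> u [[[[[_ /= ut] _] _] _] _]; have := ler_norm2D (u - w) w.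
  by rewrite subrK; lra.
- by move=> u [[[[[Cu _] _] _] _] _]; exact: FC.
have [[[[K1u /= bu] /= uw] /= uT] /= uD] := Ku; have [Cu ut] := K1u.
(* If the minimizer reaches the level [b], then [T u = t]. The last constraint of [K] bounds
   [D w - D u], which is at least [F w - b] because [w] minimizes [F - D]. *)
have [ub|ub] := eqVneq (F u) b.
  have Tut : T u = t by rewrite /T ub.
  by have := FDmin _ Cu; rewrite Tut in uD; lra.
have {}ub : b < F u by rewrite lt_neqAle eq_sym ub -subr_ge0.
have [Du gDu] := DP _ Cu (K1r _ K1u).
(* Above the level [b], one more short KL descent from [u] would stay in [K] and lower [F]. The
   radius [d1] keeps the new value above [b] and in the range where [psi] is monotone. *)
have [d1 d10 Fd1] := (continuous_norm2P _ _).1 (FC _ Cu)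
  (Num.min (F u - b) (eta - (F w - F wbar)))
  ltac:(by rewrite lt_min !subr_gt0 ub weta).
have [d2 d20 Dd2] := has_grad_local_lipschitz Du e0.
have Fu_itv : 0 < F u - F wbar < eta by apply/andP; split; lra.
have d0 : 0 < Num.min d1 d2 by rewrite lt_min d10.
have [tau [u' [/andP[tau0 +] Cu' u'u psiu']]] :=
  KL_descent C_closed F_grad KL Cu (K1r _ K1u) Fu_itv d0.
rewrite -{1}u'u lt_min => /andP[/Fd1 + /Dd2 u'D].
rewrite lt_min !ltr_norml => /andP[/andP[u'b _] /andP[_ u'eta]].
have u'u_lt : F u' < F u.
  rewrite ltNge; apply/negP => uu'.
  have := psi_le (F u - F wbar) (F u' - F wbar); rewrite lerD2r => h.
  by have := h ltac:(lra) uu' ltac:(lra); lra.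
have TT : T u + tau <= T u' by rewrite /T; lra.
have Tt : T u' <= t.
  rewrite /T /t ler_pM2l// lerD2l lerN2; apply: psi_le; lra.
have u'w : norm2 (u' - w) <= T u'.
  by have := ler_norm2_dist u u' w; rewrite u'u; lra.
have : K u'; last by move=> /umin; lra.
do !split => //=; rewrite ?subr_ge0 //; try lra.
(* The last constraint survives the step: [D] changes by at most [(norm2 (gD u) + e) * tau], where
   [norm2 (gD u) <= B * (T u + c)] because [u] is within [T u] of [w], and the growth of [T] by at
   least [tau] absorbs this. *)
have Tu0 : 0 <= T u by have := norm2_ge0 (u - w); lra.
set k := B * (T u + c) + e in uD *.
have k0 : 0 <= k by rewrite addr_ge0 ?mulr_ge0 ?addr_ge0// ltW.
have gk : norm2 (gD u) + e <= k.
  by rewrite lerD2r (le_trans gDu)// ler_wpM2l//; lra.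
have kk : k <= B * (T u' + c) + e by rewrite lerD2r ler_wpM2l// lerD2r; lra.
have h1 : k * T u' <= (B * (T u' + c) + e) * T u' by rewrite ler_wpM2r//; lra.
have h2 : k * (T u + tau) <= k * T u' by rewrite ler_wpM2l.
have h3 : (norm2 (gD u) + e) * tau <= k * tau by rewrite ler_wpM2r// ltW.
by move: u'D; rewrite u'u ler_norml => /andP[u'D _]; lra.
Qed.

End DescentLength.

(** * Abstract convergence of surrogate descent *)

Section SurrogateDescent.
Variables (R : realType) (n : nat) (C : set 'rV[R]_n) (F : 'rV[R]_n -> R)
  (gF : 'rV[R]_n -> 'rV[R]_n).
Hypotheses (C_closed : closed C) (F_grad : forall u, C u -> has_grad F u (gF u)).
Variables (w : nat -> 'rV[R]_n) (c : R).
Local Notation step k := (norm2 (w k.+1 - w k)).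
Hypotheses (c_gt0 : 0 < c) (Cw : forall k, C (w k))
  (w_bounded : exists M, forall k, norm2 (w k) <= M)
  (F_descent : forall k, F (w k.+1) + c * step k ^+ 2 <= F (w k)).

(** The constant [B] depends on the radius [rho] but not on the iteration, whereas the surrogate
    does depend on it. *)
Definition surrogate_steps := forall rho, exists2 B, 0 <= B &
  forall k, exists G gG, (forall u, C u -> G (w k.+1) <= G u) /\
    forall u, C u -> norm2 u <= rho -> has_grad G u (gG u) /\
      norm2 (gF u - gG u) <= B * (norm2 (u - w k) + step k).

Hypothesis w_surrogate : surrogate_steps.

Lemma step_ge0 k : 0 <= step k. Proof. exact: norm2_ge0. Qed.

Lemma F_nonincreasing m k : (m <= k)%N -> F (w k) <= F (w m).
Proof.
move=> mk; rewrite -(subnK mk); elim: (k - m)%N => [//|j IH].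
rewrite addSn (le_trans _ IH)//; apply: le_trans (F_descent _).
by rewrite lerDl mulr_ge0 ?sqr_ge0// ltW.
Qed.

(** Fermat's rule for the surrogate at its minimizer, with [v] the difference of the two gradients.
    The factor 2 arises because at [w k.+1] both terms of the error bound equal the step. *)
Lemma surrogate_normal : exists2 B, 0 <= B &
  forall k, exists v, regular_normal C (w k.+1) (v - gF (w k.+1)) /\
    norm2 v <= B * step k.
Proof.
have [M wM] := w_bounded; have [B B0 BP] := w_surrogate M.
exists (B * 2); first by rewrite mulr_ge0.
move=> k; have [G [gG [Gmin /(_ _ (Cw k.+1) (wM _))[Ggrad gB]]]] := BP k.
exists (gF (w k.+1) - gG (w k.+1)); split.
  rewrite addrAC subrr sub0r; apply: (local_min_regular_normal ltr01 Ggrad).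
  by move=> u Cu _; exact: Gmin.
by apply: (le_trans gB); rewrite -mulrA ler_wpM2l//; lra.
Qed.

Lemma cluster_point : exists2 wbar, C wbar &
  forall e N, 0 < e -> exists2 k, (N <= k)%N & norm2 (w k - wbar) < e.
Proof.
have [M wM] := w_bounded.
pose K := C `&` [set u | 0 <= M - norm2 (u - 0)].
have cK : compact K.
  apply: bounded_closed_compact.
    apply/bounded_norm2P; exists M => u [_ /=].
    by rewrite subr0 subr_ge0.
  apply: closedI_ge0 => // u _.
  by apply: continuousB; [exact: cst_continuous|exact: continuous_norm2_dist].
have [|wbar [[Cwbar _] wbar_cl]] := cK (w @ \oo) _.
  exists 0%N => // k _; split; [exact: Cw|by rewrite /= subr0 subr_ge0].
exists wbar => // e N e0.
have /(wbar_cl [set w k | k in [set k | (N <= k)%N]]) :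
    nbhs wbar [set u | norm2 (u - wbar) < e].
  by apply/nbhs_norm2P; exists e.
case; first by exists N => // k /= Nk; exists k.
by move=> _ [[k /= Nk <-] ke]; exists k.
Qed.

Section Cluster.
Variable wbar : 'rV[R]_n.
Hypotheses (Cwbar : C wbar)
  (wbar_cluster : forall e N, 0 < e ->
     exists2 k, (N <= k)%N & norm2 (w k - wbar) < e).

Let a k := F (w k) - F wbar.

(** A value below [F wbar] would, by monotonicity, bound all later ones away from [F wbar], against
    continuity along the iterates returning to [wbar]. *)
Lemma gap_ge0 k : 0 <= a k.
Proof.
rewrite subr_ge0 leNgt; apply/negP => ak.
have /continuous_norm2P := has_grad_continuous (F_grad Cwbar).
move=> /(_ (F wbar - F (w k))); rewrite subr_gt0 => /(_ ak)[d d0 dP].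
have [j kj /dP] := wbar_cluster k d0.
by have := F_nonincreasing kj; rewrite ltr_norml => ? /andP[]; lra.
Qed.

Lemma gap_small e : 0 < e -> exists N, forall k, (N <= k)%N -> a k < e.
Proof.
move=> e0; have /continuous_norm2P := has_grad_continuous (F_grad Cwbar).
move=> /(_ _ e0)[d d0 dP]; have [N _ /dP] := wbar_cluster 0 d0.
rewrite ltr_norml => /andP[_ aN]; exists N => k /F_nonincreasing.
by rewrite /a; lra.
Qed.

Lemma gap_step k : c * step k ^+ 2 <= a k - a k.+1.
Proof. by have := F_descent k; rewrite /a; lra. Qed.

Lemma step_small e : 0 < e -> exists N, forall k, (N <= k)%N -> step k < e.
Proof.
move=> e0; have [|N NP] := @gap_small (c * e ^+ 2).
  by rewrite mulr_gt0// exprn_gt0.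
exists N => k /NP ak; rewrite -(@ltr_pXn2r _ 2)// ?nnegrE ?step_ge0 ?ltW//.
rewrite -(ltr_pM2l c_gt0).
by have := gap_step k; have := gap_ge0 k.+1; lra.
Qed.

Lemma frequently_small e : 0 < e ->
  exists k, [/\ norm2 (w k.+1 - wbar) < e, step k < e & a k < e].
Proof.
move=> e0; have [N1 N1P] := step_small e0; have [N2 N2P] := gap_small e0.
(* The successor makes the index found of the form [k.+1] with [k] beyond both thresholds. *)
have [[|k]] := wbar_cluster (maxn N1 N2).+1 e0; first by [].
rewrite ltnS geq_max => /andP[/N1P ? /N2P ?] ?.
by exists k; split.
Qed.

(** The KL property is assumed only where the subdifferential is nonempty. At [wbar] it contains 0,
    the limit of the subgradients of [surrogate_normal] along indices returning to [wbar]. *)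
Lemma cluster_dom_subdiff (Psi : 'rV[R]_n -> \bar R) :
  (forall u, Psi u = if u \in C then (F u)%:E else +oo%E) -> dom_subdiff Psi wbar.
Proof.
move=> PsiE; have [B B0 /choice[v vP]] := surrogate_normal.
have PsiC u : C u -> Psi u = (F u)%:E by move=> Cu; rewrite PsiE mem_set.
have /choice[k kP] : forall j : nat, exists k, [/\ norm2 (w k.+1 - wbar) < j.+1%:R^-1,
    step k < j.+1%:R^-1 & a k < j.+1%:R^-1].
  by move=> j; apply: frequently_small; rewrite invr_gt0.
have small e : 0 < e -> \forall j \near \oo, j.+1%:R^-1 < e :> R.
  by move=> e0; apply: near_infty_natSinv_lt (PosNum e0).
exists 0; split; first by rewrite /dom/= PsiC// ltry.
exists (fun j => w (k j).+1), (fun j => v (k j)); split.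
- apply/cvg_norm2P => e /small; apply: filterS => j.
  by have [+ _ _] := kP j; exact: lt_trans.
- rewrite PsiC//; under eq_fun do rewrite PsiC//.
  apply: cvg_EFin; first by apply: nearW.
  apply/cvgrPdist_lt => e /small; apply: filterS => j je /=.
  have [_ _ aj] := kP j; have := F_descent (k j); have := gap_ge0 (k j).+1.
  have : 0 <= c * step (k j) ^+ 2 by rewrite mulr_ge0 ?sqr_ge0 ?ltW.
  move: (lt_trans aj je); rewrite ltr_norml /a => *.
  by apply/andP; split; lra.
- apply/cvg_norm2P => e e0; have B1 : 0 < B + 1 by rewrite ltr_wpDl.
  have : 0 < e / (B + 1) by rewrite divr_gt0.
  move=> /small; apply: filterS => j je; rewrite subr0.
  have [_ sj _] := kP j; apply: (le_lt_trans (vP (k j)).2).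
  have := lt_trans sj je; rewrite ltr_pdivlMr// => h; apply: le_lt_trans h.
  by rewrite mulrC ler_wpM2l ?step_ge0// lerDl.
- move=> j; rewrite -[v _](subrKC (gF (w (k j).+1))).
  apply: (smooth_plus_indicator_regular_subdiff PsiE) => //.
    exact: F_grad.
  exact: (vP _).1.
Qed.

Section Convergence.
Variables (eta r : R) (psi : R -> R) (B K : R).
Hypotheses (KL : smooth_KL_at C F gF wbar eta r psi) (B_ge0 : 0 <= B)
  (K_ge1 : 1 <= K) (cK : c * K = 2 * B + c)
  (B_surrogate : forall k, exists G gG, (forall u, C u -> G (w k.+1) <= G u) /\
    forall u, C u -> norm2 u <= norm2 wbar + r -> has_grad G u (gG u) /\
      norm2 (gF u - gG u) <= B * (norm2 (u - w k) + step k)).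
Let phi k := psi (a k).
(** A Lyapunov function that traps the iterates near [wbar]: [step_contraction] bounds two copies of
    [step k.+1], one kept in the next energy and one paying for the motion of the iterate. *)
Let energy k := norm2 (w k.+1 - wbar) + step k + 4 * K * phi k.+1.

Lemma phi_nonincreasing k : a k < eta -> phi k.+1 <= phi k.
Proof.
move=> ak; have [_ _ [_ _ _ psi_lt] _] := KL.
have : a k.+1 <= a k.
  have : 0 <= c * step k ^+ 2 by rewrite mulr_ge0 ?sqr_ge0 ?ltW.
  by have := gap_step k; lra.
rewrite le_eqVlt => /predU1P[akk|akk]; first by rewrite /phi akk.
by apply/ltW/psi_lt => //; exact: gap_ge0.
Qed.

Lemma phi_ge0 k : a k < eta -> 0 <= phi k.
Proof.
move=> ak; have [_ _ [psi0 _ _ psi_lt] _] := KL.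
have := gap_ge0 k; rewrite le_eqVlt => /predU1P[ak0|ak0].
  by rewrite /phi -ak0 psi0.
by rewrite -psi0; apply/ltW/psi_lt.
Qed.

Lemma gap_lt_next k : a k < eta -> a k.+1 < eta.
Proof.
have : 0 <= c * step k ^+ 2 by rewrite mulr_ge0 ?sqr_ge0 ?ltW.
by have := gap_step k; lra.
Qed.

(** [KL_level_gap] is applied at [w k.+1], down to the level of [w k.+2], with [D] the difference of
    [F] and its surrogate. *)
Lemma step_contraction k : a k.+1 < eta -> energy k < r ->
  2 * step k.+1 + 4 * K * phi k.+2 <= step k + 4 * K * phi k.+1.
Proof.
move=> ak Er; pose t := 2 * (phi k.+1 - phi k.+2).
have t0 : 0 <= t by rewrite mulr_ge0// subr_ge0 phi_nonincreasing.
have [s0 K1] := (step_ge0 k, K_ge1).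
have phi2_ge0 : 0 <= phi k.+2 by exact/phi_ge0/gap_lt_next.
have gap : a k.+1 - a k.+2 <= B * (t + 2 * step k) * t.
  have [G [gG [Gmin GP]]] := B_surrogate k.
  rewrite /a opprB addrA subrK.
  apply: (KL_level_gap C_closed F_grad (D := fun u => F u - G u)
    (gD := fun u => gF u - gG u) KL (Cw _)) => //.
  - by have := gap_ge0 k.+2; rewrite /a subr_ge0.
  - exact: F_nonincreasing.
  - rewrite -/(a _) -/(a _) -/(phi _) -/(phi _) -/t.
    apply: le_lt_trans Er; rewrite /energy -addrA lerD2l.
    have : 2 * phi k.+1 <= 4 * K * phi k.+1.
      by rewrite ler_wpM2r ?phi_ge0//; lra.
    by rewrite /t; lra.
  - by rewrite mulr_ge0 ?step_ge0.
  - move=> u Cu ur; have [|Gu gB] := GP _ Cu.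
      by have := ler_norm2D (u - wbar) wbar; rewrite subrK; lra.
    split; first by apply: has_gradB => //; exact: F_grad.
    apply: (le_trans gB); rewrite ler_wpM2l//.
    by have := ler_norm2_dist (w k.+1) u (w k); lra.
  - by move=> u /Gmin; lra.
suff : step k.+1 <= step k / 2 + K * t by rewrite /t; lra.
have st : 0 <= step k / 2 + K * t.
  have : 0 <= K * t by apply: mulr_ge0 => //; lra.
  by lra.
rewrite -(@ler_pXn2r _ 2)// ?nnegrE ?step_ge0// -(ler_pM2l c_gt0).
apply: (le_trans (gap_step _)); apply: (le_trans gap).
have stt : 0 <= step k * t by rewrite mulr_ge0.
have t2 : 0 <= t ^+ 2 by rewrite sqr_ge0.
(* By the choice of [K], the cross term dominates [2 * B * (step k * t)] and the last term dominates
   [B * t ^+ 2]. *)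
have -> : c * (step k / 2 + K * t) ^+ 2 =
    c * step k ^+ 2 / 4 + (c * K) * (step k * t) + (c * K) * K * t ^+ 2 by field.
have : 0 <= c * step k ^+ 2 / 4.
  by rewrite divr_ge0// mulr_ge0 ?sqr_ge0// ltW.
have : B * t ^+ 2 <= c * K * K * t ^+ 2.
  rewrite ler_wpM2r//; apply: (@le_trans _ _ (c * K)); last first.
    by rewrite ler_peMr// cK addr_ge0 ?mulr_ge0 ?(ltW c_gt0).
  by rewrite cK mulr_natl mulr2n -addrA lerDl addr_ge0// ltW.
have : 2 * B * (step k * t) <= c * K * (step k * t).
  by rewrite ler_wpM2r// cK lerDl ltW.
by lra.
Qed.

Lemma energy_nonincreasing k e : a k.+1 < eta -> energy k < e -> e <= r ->
  forall j, a (k + j).+1 < eta /\ energy (k + j) < e.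
Proof.
move=> ak Ek er; elim=> [|j [IHa IHE]]; first by rewrite addn0.
rewrite addnS; split; first exact: gap_lt_next.
have := step_contraction IHa (lt_le_trans IHE er).
have := ler_norm2_dist (w (k + j).+1) (w (k + j).+2) wbar.
by move: IHE; rewrite /energy; lra.
Qed.

Lemma energy_small e : 0 < e -> exists k, a k.+1 < eta /\ energy k < e.
Proof.
move=> e0; have [eta0 _ [psi0 psic _ _] _] := KL.
have K0 : 0 < 12 * K by rewrite mulr_gt0// (lt_le_trans ltr01).
(* Each of the three terms of the energy is made smaller than [e / 3]. *)
have /cvgrPdist_lt/(_ (e / (12 * K))) := psic _ eta0.
rewrite divr_gt0// => /(_ isT)/nbhs_ballP[d /= d0 dP].
have [|k [ke se ad]] := @frequently_small (Num.min (e / 3) (Num.min d eta)).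
  by rewrite !lt_min d0 eta0 divr_gt0.
move: ke se ad; rewrite !lt_min => /and3P[ke _ _] /and3P[se _ _] /and3P[_ ad ae].
exists k; split; first exact: gap_lt_next.
have a1 := gap_ge0 k.+1.
have a1a : a k.+1 <= a k by rewrite lerD2r F_nonincreasing.
have := dP (a k.+1); rewrite -ball_normE/= sub0r normrN ger0_norm//.
move=> /(_ (le_lt_trans a1a ad)); rewrite psi0 sub0r normrN.
move=> /(le_lt_trans (ler_norm _)).
by rewrite ltr_pdivlMr// -/(phi _) /energy; lra.
Qed.

Lemma surrogate_cvg : w k @[k --> \oo] --> wbar.
Proof.
have [_ r0 _ _] := KL; apply/cvg_norm2P => e e0.
have [|k [ak Ek]] := @energy_small (Num.min e r); first by rewrite lt_min e0.
have := energy_nonincreasing ak Ek; rewrite ge_min lexx orbT => /(_ isT) EP.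
exists k.+1 => // -[//|j] /=; rewrite ltnS => kj.
have := EP (j - k)%N; rewrite subnKC// => -[aj]; rewrite lt_min => /andP[+ _].
have := step_ge0 j.
have : 0 <= 4 * K * phi j.+1.
  by rewrite !mulr_ge0 ?phi_ge0// (le_trans ler01).
by rewrite /energy; lra.
Qed.

Lemma surrogate_finite_length : exists M, forall N, \sum_(0 <= k < N) step k <= M.
Proof.
have [_ r0 _ _] := KL; have [k [ak Ek]] := energy_small r0.
have EP := energy_nonincreasing ak Ek (lexx r).
(* [step_contraction] makes the partial length plus the last step plus the [phi] term nonincreasing
   from index [k] on; [M] is its initial value. *)
pose M := \sum_(0 <= i < k.+1) step i + step k + 4 * K * phi k.+1; exists M => N.
have MP j : \sum_(0 <= i < (k + j).+1) step i + step (k + j) +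
    4 * K * phi (k + j).+1 <= M.
  elim: j => [|j IH]; first by rewrite addn0.
  rewrite addnS big_nat_recr//=; apply: le_trans IH.
  by have := step_contraction (EP j).1 (EP j).2; lra.
apply: le_trans (MP N); rewrite -addrA ler_wpDr//.
  rewrite addr_ge0 ?step_ge0// !mulr_ge0 ?phi_ge0 ?(EP N).1//.
  exact: le_trans ler01 K_ge1.
rewrite [leRHS](@big_cat_nat _ _ _ N)//=; last by rewrite ltnW// ltnS leq_addl.
by rewrite lerDl sumr_ge0// => i _; exact: step_ge0.
Qed.

End Convergence.
End Cluster.

Theorem surrogate_descent_convergence (Psi : 'rV[R]_n -> \bar R) :
  (forall u, Psi u = if u \in C then (F u)%:E else +oo%E) -> KL_function Psi ->
  exists wbar, [/\ C wbar, w k @[k --> \oo] --> wbar,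
    exists M, forall N, \sum_(0 <= k < N) step k <= M &
    exists v : nat -> 'rV[R]_n, v k @[k --> \oo] --> (0 : 'rV[R]_n) /\
      forall k, regular_normal C (w k.+1) (v k - gF (w k.+1))].
Proof.
move=> PsiE [_ _ PsiKL]; have [wbar Cwbar wbar_cl] := cluster_point.
have := PsiKL _ (cluster_dom_subdiff Cwbar wbar_cl PsiE).
move=> /(KL_at_smooth F_grad PsiE Cwbar)[eta [r [psi KL]]].
(* This ball around 0 contains the KL ball of radius [r] around [wbar]. *)
have [B B0 BP] := w_surrogate (norm2 wbar + r).
have K1 : 1 <= 2 * B / c + 1 by rewrite lerDr divr_ge0 ?mulr_ge0// ltW.
have cK : c * (2 * B / c + 1) = 2 * B + c by field; exact: lt0r_neq0.
exists wbar; split => //.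
- exact: (surrogate_cvg Cwbar wbar_cl KL B0 K1 cK BP).
- exact: (surrogate_finite_length Cwbar wbar_cl KL B0 K1 cK BP).
have [B' B'0 /choice[v vP]] := surrogate_normal.
exists v; split; last by move=> k; exact: (vP k).1.
apply/cvg_norm2P => e e0; have B1 : 0 < B' + 1 by rewrite ltr_wpDl.
have [|N NP] := step_small Cwbar wbar_cl (e := e / (B' + 1)).
  by rewrite divr_gt0.
exists N => // k /= /NP; rewrite subr0 ltr_pdivlMr// => h.
apply: (le_lt_trans (vP k).2); apply: le_lt_trans h.
by rewrite mulrC ler_wpM2l ?step_ge0// lerDl.
Qed.

End SurrogateDescent.

(** * Finite families and nonexpansive maps *)

Section FiniteBounds.
Variables (R : realType) (N : nat).
Implicit Type a : 'I_N -> R.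

Lemma finite_lower_bound a : (forall i, 0 < a i) ->
  exists2 c, 0 < c & forall i, c <= a i.
Proof.
move=> a0; exists (\big[Num.min/1]_i a i); first by apply: lt_bigmin.
by move=> i; exact: bigmin_le.
Qed.

Lemma finite_upper_bound a : exists2 A, 0 <= A & forall i, a i <= A.
Proof.
exists (\sum_i `|a i|) => [|i]; first by apply: sumr_ge0.
rewrite (bigD1 i)//= (le_trans (ler_norm _))// lerDl.
by apply: sumr_ge0.
Qed.

End FiniteBounds.

Section Nonexpansive.
Variables (R : realType) (m n : nat) (phi : 'rV[R]_m -> 'rV[R]_n).
Hypothesis phi_nonexp : forall u v, norm2 (phi u - phi v) <= norm2 (u - v).

Lemma closed_preimage_nonexpansive (A : set 'rV[R]_n) :
  closed A -> closed (phi @^-1` A).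
Proof.
move=> cA u Au; apply: cA => V /nbhs_norm2P[d d0 dV].
have /Au[v [Av vd]] : nbhs u [set v | norm2 (v - u) < d].
  by apply/nbhs_norm2P; exists d.
by exists (phi v); split => //; apply/dV/(le_lt_trans (phi_nonexp _ _)).
Qed.

Lemma cvg_nonexpansive (us : nat -> 'rV[R]_m) u :
  us k @[k --> \oo] --> u -> phi (us k) @[k --> \oo] --> phi u.
Proof.
move=> /cvg_norm2P usu; apply/cvg_norm2P => e /usu; apply: filterS => k.
exact: le_lt_trans (phi_nonexp _ _).
Qed.

End Nonexpansive.

(** A directional derivative sees only the values along a line. Partial gradients are thereby
    identified with components of the full gradient. *)
Lemma eq_derive (R : realType) (U V : normedModType R) (f : U -> R) (g : V -> R)
    a v b w : (forall h : R, f (h *: v + a) = g (h *: w + b)) ->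
  ('D_v f a = 'D_w g b) /\ (derivable g b w -> derivable f a v).
Proof.
move=> fg; have fgE : (fun h : R => h^-1 *: ((f \o shift a) (h *: v) - f a)) =
    (fun h : R => h^-1 *: ((g \o shift b) (h *: w) - g b)).
  apply/funext => h /=; rewrite fg; have := fg 0.
  by rewrite !scale0r !add0r => ->.
by rewrite /derive /derivable fgE.
Qed.

(** * The quadratic upper bound for a Lipschitz gradient *)

Section DescentLemma.
Variables (R : realType) (n : nat) (f : 'rV[R]_n -> R) (L : R).
Hypotheses (f_diff : forall u, differentiable f u)
  (f_lip : forall u v, norm2 (grad f u - grad f v) <= L * norm2 (u - v)).

Lemma descent_lemma u v :
  f v <= f u + dotv (v - u) (grad f u) + L / 2 * norm2 (v - u) ^+ 2.
Proof.
set d := v - u; pose line (t : R) : R := f (t *: d + u).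
have gradE w h : 'D_h f w = dotv (grad f w) h.
  rewrite deriveE// {1}(row_sum_delta h) linear_sum; apply: eq_bigr => j _.
  by rewrite linearZ/= mxE deriveE// mulrC.
have line_derive (t : R) : is_derive t 1 line (dotv (grad f (t *: d + u)) d).
  have [|lineE linedf] := @eq_derive R R^o _ line f t 1 (t *: d + u) d.
    by move=> h; rewrite /line -[h *: 1]/(h * 1) mulr1 scalerDl addrA.
  by rewrite -gradE -lineE; apply/derivableP/linedf/diff_derivable.
(* By Cauchy-Schwarz and the Lipschitz bound, [q] has nonpositive derivative on the open unit
   interval; [q 1 <= q 0] is the claim. *)
pose q (t : R) : R := line t - (dotv (grad f u) d * t + L / 2 * norm2 d ^+ 2 * t ^+ 2).
have q_derive (t : R) : is_derive t 1 q (dotv (grad f (t *: d + u)) d -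
    (dotv (grad f u) d + L * t * norm2 d ^+ 2)).
  apply: is_derive_eq.
  by rewrite /GRing.scale/=; field.
have : q 1 <= q 0.
  apply: (@ler0_derive1_le_cc _ q 0 1) => //.
  - move=> t; rewrite in_itv/= => /andP[t0 _].
    rewrite derive1E derive_val opprD addrA -dotvBl subr_le0.
    apply: (le_trans (cauchy_schwarz _ _)).
    apply: (le_trans (ler_wpM2r (norm2_ge0 _) (f_lip _ _))).
    by rewrite addrK norm2Z gtr0_norm// expr2 !mulrA.
  - apply: continuous_subspaceT => t.
    exact/differentiable_continuous/derivable1_diffP.
  - by rewrite in_itv/= lexx ler01.
  - by rewrite in_itv/= lexx ler01.
rewrite /q /line scale1r scale0r add0r subrK expr1n expr0n/= !mulr0 (dotvC d).
by lra.
Qed.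

End DescentLemma.

(** * Block decomposition of vectors and gradients *)

Section BlockTheory.
Variables (R : realType) (N : nat) (p : 'I_N -> nat).
Notation Rp := 'rV[R]_(\sum_i p i).
Implicit Types (u v x : Rp) (f : Rp -> R) (A : forall i, set 'rV[R]_(p i)).

Lemma submxrowD u v i : submxrow (u + v) i = submxrow u i + submxrow v i.
Proof. by apply/rowP => j; rewrite !mxE. Qed.

Lemma submxrowB u v i : submxrow (u - v) i = submxrow u i - submxrow v i.
Proof. by apply/rowP => j; rewrite !mxE. Qed.

Lemma submxrow_inj u v : (forall i, submxrow u i = submxrow v i) -> u = v.
Proof.
by move=> uv; rewrite -[u]submxrowK -[v]submxrowK; apply: eq_mxrow.
Qed.

Lemma dotv_blocks u v : dotv u v = \sum_i dotv (submxrow u i) (submxrow v i).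
Proof.
rewrite [RHS]sig_big_dep /= /dotv.
rewrite (reindex _ tagnat.rank_bij_on)/=.
by apply: eq_bigr => -[i j] _; rewrite !mxE.
Qed.

Lemma sqr_norm2_blocks u : norm2 u ^+ 2 = \sum_i norm2 (submxrow u i) ^+ 2.
Proof. by rewrite sqr_norm2 dotv_blocks; under [RHS]eq_bigr do rewrite sqr_norm2. Qed.

Lemma ler_norm2_block u i : norm2 (submxrow u i) <= norm2 u.
Proof.
rewrite -(@ler_pXn2r _ 2)// ?nnegrE ?norm2_ge0// sqr_norm2_blocks (bigD1 i)//=.
by rewrite lerDl sumr_ge0// => j _; rewrite sqr_ge0.
Qed.

Lemma norm2_block_scale (a : 'I_N -> R) (M : R) v : (forall i, `|a i| <= M) ->
  0 <= M -> norm2 (\mxrow_i (a i *: submxrow v i)) <= M * norm2 v.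
Proof.
move=> aM M0; rewrite -(@ler_pXn2r _ 2)// ?nnegrE ?mulr_ge0 ?norm2_ge0//.
rewrite exprMn !sqr_norm2_blocks mulr_sumr; apply: ler_sum => i _.
rewrite mxrowK norm2Z exprMn ler_wpM2r ?sqr_ge0// ler_pXn2r ?nnegrE//.
Qed.

Lemma submxrow_set_block x i (u : 'rV[R]_(p i)) : submxrow (set_block x u) i = u.
Proof. by rewrite /set_block mxrowK dfwithin. Qed.

Lemma submxrow_set_block_neq x i (u : 'rV[R]_(p i)) l : i != l ->
  submxrow (set_block x u) l = submxrow x l.
Proof. by move=> il; rewrite /set_block mxrowK dfwithout. Qed.

Lemma set_block_id x i : set_block x (submxrow x i) = x.
Proof.
apply: submxrow_inj => l; have [<-|il] := eqVneq i l.
  by rewrite submxrow_set_block.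
by rewrite submxrow_set_block_neq.
Qed.

Lemma set_block_set x i (u v : 'rV[R]_(p i)) :
  set_block (set_block x u) v = set_block x v.
Proof.
apply: submxrow_inj => l; have [<-|il] := eqVneq i l.
  by rewrite !submxrow_set_block.
by rewrite !submxrow_set_block_neq.
Qed.

Lemma block_gradE f i x : block_grad f i x = submxrow (grad f x) i.
Proof.
apply/rowP => j; rewrite !mxE; apply: (eq_derive _).1 => h; congr f.
apply: submxrow_inj => l; rewrite submxrowD.
have [<-|il] := eqVneq i l.
  rewrite submxrow_set_block; congr (_ + _); apply/rowP => k; rewrite !mxE/=.
  by rewrite (inj_eq (@tagnat.rank_inj _ _)) eq_Tagged.
rewrite submxrow_set_block_neq// -[LHS]add0r; congr (_ + _); apply/rowP => k.
rewrite !mxE/= (inj_eq (@tagnat.rank_inj _ _)).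
by rewrite -tag_eqE /tag_eq/= eq_sym (negbTE il) mulr0.
Qed.

Lemma block_grad_set_block f i x (u : 'rV[R]_(p i)) :
  block_grad f i (set_block x u) = grad (fun v : 'rV[R]_(p i) => f (set_block x v)) u.
Proof.
rewrite /block_grad submxrow_set_block; congr (grad _ u).
by apply/funext => v; rewrite set_block_set.
Qed.

Lemma separable_block_grad A f x x' i : separable_grad A f ->
  block_prod A x -> block_prod A x' -> submxrow x i = submxrow x' i ->
  block_grad f i x = block_grad f i x'.
Proof. by move=> [g gE] Ax Ax' xx'; rewrite !block_gradE !gE// !mxrowK xx'. Qed.

(* Updating the blocks one after the other, separability lets each partial
   gradient be evaluated at the initial point. *)
Lemma block_descent A f (L : 'I_N -> R) x x' :
  (forall i, block_grad_lipschitz A f i (L i)) -> separable_grad A f ->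
  block_prod A x -> block_prod A x' ->
  f x' <= f x + \sum_i (dotv (submxrow x' i - submxrow x i) (block_grad f i x) +
                        L i / 2 * norm2 (submxrow x' i - submxrow x i) ^+ 2).
Proof.
move=> f_lip f_sep Ax Ax'.
pose xi m : Rp := \mxrow_i (if (i < m)%N then submxrow x' i else submxrow x i).
pose T i := dotv (submxrow x' i - submxrow x i) (block_grad f i x) +
  L i / 2 * norm2 (submxrow x' i - submxrow x i) ^+ 2.
have Axi m : block_prod A (xi m) by move=> i; rewrite mxrowK; case: ifP.
suff xiP m : (m <= N)%N -> f (xi m) <= f x + \sum_(i < N | (i < m)%N) T i.
  have := xiP N (leqnn N); have -> : xi N = x'.
    by apply: submxrow_inj => i; rewrite mxrowK ltn_ord.
  by rewrite (eq_bigl xpredT)// => i; rewrite ltn_ord.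
elim: m => [_|m IHm mN].
  rewrite big_pred0 ?addr0//; have -> // : xi 0%N = x.
  by apply: submxrow_inj => i; rewrite mxrowK.
pose i := Ordinal mN; have xii : submxrow (xi m) i = submxrow x i.
  by rewrite mxrowK/= ltnn.
have xiS : xi m.+1 = set_block (xi m) (submxrow x' i).
  apply: submxrow_inj => l; have [<-|il] := eqVneq i l.
    by rewrite submxrow_set_block mxrowK/= ltnSn.
  rewrite submxrow_set_block_neq// !mxrowK ltnS leq_eqVlt.
  by move: il; rewrite -val_eqE/= eq_sym => /negbTE ->.
(* The blocks of [xi m] lie in [A], so the descent lemma applies to its block [i]. That block still
   has its old value, whence separability moves the gradient from [xi m] to [x]. *)
have [df lip] := f_lip i (xi m) (fun l _ => Axi m l).
have := @descent_lemma _ _ _ (L i) df _ (submxrow (xi m) i) (submxrow x' i).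
rewrite -xiS set_block_id -block_grad_set_block set_block_id.
rewrite (separable_block_grad f_sep (Axi m) Ax xii) xii => h.
have {}h := h _; rewrite (bigD1 i)//=.
rewrite (eq_bigl (fun l : 'I_N => (l < m)%N)); last first.
  by move=> l; rewrite ltnS -val_eqE/= [in RHS]ltn_neqAle andbC.
have := IHm (ltnW mN); rewrite -/(T i) => IH.
apply: (le_trans (h _)); last by rewrite /T; lra.
by move=> u v; rewrite -!block_grad_set_block.
Qed.

Lemma has_grad_blocks (f : forall i, 'rV[R]_(p i) -> R) g x :
  (forall i, has_grad (f i) (submxrow x i) (g i)) ->
  has_grad (fun x => \sum_i f i (submxrow x i)) x (\mxrow_i g i).
Proof.
move=> fg e e0; have N1 : 0 < N%:R + 1 :> R by rewrite ltr_wpDl.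
have eN : 0 < e / (N%:R + 1) by rewrite divr_gt0.
have /choice[d dP] i : exists d, 0 < d /\ forall w, norm2 (w - submxrow x i) < d ->
    `|f i w - f i (submxrow x i) - dotv (g i) (w - submxrow x i)| <=
      e / (N%:R + 1) * norm2 (w - submxrow x i).
  by have [d d0 dP] := fg i _ eN; exists d.
have [d0 d00 d0P] := finite_lower_bound (fun i => (dP i).1).
exists d0 => // w wx; rewrite dotv_blocks -!sumrB.
apply: (le_trans (ler_norm_sum _ _ _)).
apply: (@le_trans _ _ (\sum_(i < N) e / (N%:R + 1) * norm2 (w - x))).
  apply: ler_sum => i _; rewrite mxrowK submxrowB.
  have wxi : norm2 (submxrow w i - submxrow x i) <= norm2 (w - x).
    by rewrite -submxrowB ler_norm2_block.
  apply: (le_trans ((dP i).2 _ _)).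
    exact: le_lt_trans wxi (lt_le_trans wx (d0P i)).
  by rewrite ler_wpM2l// ltW.
rewrite sumr_const card_ord -[leLHS]mulr_natr mulrAC ler_wpM2r ?norm2_ge0//.
by rewrite mulrAC ler_pdivrMr// ler_wpM2l ?lerDl// ltW.
Qed.

End BlockTheory.

(** * Triples of vectors and products of three sets *)

Section TripleTheory.
Variables (R : realType) (m n r : nat).
Implicit Types (x : 'rV[R]_m) (y : 'rV[R]_n) (z : 'rV[R]_r)
  (u v w : 'rV[R]_(m + n + r)) (F : 'rV[R]_(m + n + r) -> R).

Definition fst3 w : 'rV[R]_m := lsubmx (lsubmx w).
Definition snd3 w : 'rV[R]_n := rsubmx (lsubmx w).
Definition trd3 w : 'rV[R]_r := rsubmx w.

Lemma fst3K x y z : fst3 (triple x y z) = x.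
Proof. by rewrite /fst3 !row_mxKl. Qed.

Lemma snd3K x y z : snd3 (triple x y z) = y.
Proof. by rewrite /snd3 row_mxKl row_mxKr. Qed.

Lemma trd3K x y z : trd3 (triple x y z) = z.
Proof. by rewrite /trd3 row_mxKr. Qed.

Lemma triple_eta w : triple (fst3 w) (snd3 w) (trd3 w) = w.
Proof. by rewrite /triple !hsubmxK. Qed.

Lemma tripleB x y z x' y' z' :
  triple x y z - triple x' y' z' = triple (x - x') (y - y') (z - z').
Proof. by rewrite /triple !opp_row_mx !add_row_mx. Qed.

Lemma fst3B u v : fst3 (u - v) = fst3 u - fst3 v.
Proof. by rewrite -{1}(triple_eta u) -{1}(triple_eta v) tripleB fst3K. Qed.

Lemma snd3B u v : snd3 (u - v) = snd3 u - snd3 v.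
Proof. by rewrite -{1}(triple_eta u) -{1}(triple_eta v) tripleB snd3K. Qed.

Lemma trd3B u v : trd3 (u - v) = trd3 u - trd3 v.
Proof. by rewrite -{1}(triple_eta u) -{1}(triple_eta v) tripleB trd3K. Qed.

Lemma dotv_row_mx k l (a c : 'rV[R]_k) (b d : 'rV[R]_l) :
  dotv (row_mx a b) (row_mx c d) = dotv a c + dotv b d.
Proof.
rewrite /dotv big_split_ord; congr (_ + _); apply: eq_bigr => j _.
  by rewrite !row_mxEl.
by rewrite !row_mxEr.
Qed.

Lemma dotv_triple u v :
  dotv u v = dotv (fst3 u) (fst3 v) + dotv (snd3 u) (snd3 v) +
             dotv (trd3 u) (trd3 v).
Proof. by rewrite -{1}(triple_eta u) -{1}(triple_eta v) !dotv_row_mx. Qed.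

Lemma sqr_norm2_triple u : norm2 u ^+ 2 =
  norm2 (fst3 u) ^+ 2 + norm2 (snd3 u) ^+ 2 + norm2 (trd3 u) ^+ 2.
Proof. by rewrite !sqr_norm2 dotv_triple. Qed.

Lemma ler_norm2_sqr k l (a : 'rV[R]_k) (b : 'rV[R]_l) :
  norm2 a ^+ 2 <= norm2 b ^+ 2 -> norm2 a <= norm2 b.
Proof. by rewrite ler_pXn2r ?nnegrE ?norm2_ge0. Qed.

Lemma ler_norm2_fst3 u : norm2 (fst3 u) <= norm2 u.
Proof.
by apply: ler_norm2_sqr; rewrite sqr_norm2_triple -addrA lerDl addr_ge0 ?sqr_ge0.
Qed.

Lemma ler_norm2_snd3 u : norm2 (snd3 u) <= norm2 u.
Proof.
apply: ler_norm2_sqr; rewrite sqr_norm2_triple addrAC lerDr.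
by rewrite addr_ge0 ?sqr_ge0.
Qed.

Lemma ler_norm2_trd3 u : norm2 (trd3 u) <= norm2 u.
Proof.
by apply: ler_norm2_sqr; rewrite sqr_norm2_triple lerDr addr_ge0 ?sqr_ge0.
Qed.

Lemma fst3_nonexpansive u v : norm2 (fst3 u - fst3 v) <= norm2 (u - v).
Proof. by rewrite -fst3B ler_norm2_fst3. Qed.

Lemma snd3_nonexpansive u v : norm2 (snd3 u - snd3 v) <= norm2 (u - v).
Proof. by rewrite -snd3B ler_norm2_snd3. Qed.

Lemma trd3_nonexpansive u v : norm2 (trd3 u - trd3 v) <= norm2 (u - v).
Proof. by rewrite -trd3B ler_norm2_trd3. Qed.

Lemma ler_norm2_triple u :
  norm2 u <= norm2 (fst3 u) + norm2 (snd3 u) + norm2 (trd3 u).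
Proof.
rewrite -(@ler_pXn2r _ 2)// ?nnegrE ?addr_ge0 ?norm2_ge0// sqr_norm2_triple.
have a0 := norm2_ge0 (fst3 u); have b0 := norm2_ge0 (snd3 u).
have c0 := norm2_ge0 (trd3 u).
have ab := mulr_ge0 a0 b0; have ac := mulr_ge0 a0 c0; have bc := mulr_ge0 b0 c0.
by lra.
Qed.

Lemma row_mx_delta_l k l (j : 'I_k) :
  row_mx (delta_mx 0 j) 0 = delta_mx 0 (lshift l j) :> 'rV[R]_(k + l).
Proof.
apply/rowP => i; case: (split_ordP i) => s ->.
  by rewrite row_mxEl !mxE eq_lshift.
by rewrite row_mxEr !mxE eq_rlshift.
Qed.

Lemma row_mx_delta_r k l (j : 'I_l) :
  row_mx 0 (delta_mx 0 j) = delta_mx 0 (rshift k j) :> 'rV[R]_(k + l).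
Proof.
apply/rowP => i; case: (split_ordP i) => s ->.
  by rewrite row_mxEl !mxE eq_lrshift.
by rewrite row_mxEr !mxE eq_rshift.
Qed.

Lemma grad_fst3 F x y z :
  grad (fun x' => F (triple x' y z)) x = fst3 (grad F (triple x y z)).
Proof.
apply/rowP => j; rewrite !mxE; apply: (eq_derive _).1 => h; congr F.
by rewrite -!row_mx_delta_l !scale_row_mx !scaler0 !add_row_mx !add0r.
Qed.

Lemma grad_snd3 F x y z :
  grad (fun y' => F (triple x y' z)) y = snd3 (grad F (triple x y z)).
Proof.
apply/rowP => j; rewrite !mxE; apply: (eq_derive _).1 => h; congr F.
rewrite -row_mx_delta_l -row_mx_delta_r !scale_row_mx !scaler0 !add_row_mx.
by rewrite !add0r.
Qed.

Lemma has_grad_trd3 F x y z g : has_grad F (triple x y z) g ->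
  has_grad (fun z' => F (triple x y z')) z (trd3 g).
Proof.
move=> Fg e /Fg[d d0 dP]; exists d => // z'.
have E : triple x y z' - triple x y z = triple 0 0 (z' - z).
  by rewrite tripleB !subrr.
have N : norm2 (triple (0 : 'rV[R]_m) (0 : 'rV[R]_n) (z' - z)) = norm2 (z' - z).
  apply/eqP; rewrite -(@eqrXn2 _ 2)// ?norm2_ge0// sqr_norm2_triple.
  by rewrite fst3K snd3K trd3K !norm2_0 expr0n/= !add0r.
move=> zz'; have := dP (triple x y z'); rewrite E N => /(_ zz').
by rewrite dotv_triple fst3K snd3K trd3K !dotv0r !add0r.
Qed.

Lemma has_grad_triple f1 f2 f3 g1 g2 g3 w : has_grad f1 (fst3 w) g1 ->
  has_grad f2 (snd3 w) g2 -> has_grad f3 (trd3 w) g3 ->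
  has_grad (fun w => f1 (fst3 w) + f2 (snd3 w) + f3 (trd3 w)) w
    (triple g1 g2 g3).
Proof.
move=> h1 h2 h3 e e0; have e3 : 0 < e / 3 by rewrite divr_gt0.
have [d1 d10 P1] := h1 _ e3; have [d2 d20 P2] := h2 _ e3.
have [d3 d30 P3] := h3 _ e3.
exists (Num.min d1 (Num.min d2 d3)); first by rewrite !lt_min d10 d20.
move=> u; rewrite !lt_min => /and3P[u1 u2 u3].
have n1 := ler_norm2_fst3 (u - w); have n2 := ler_norm2_snd3 (u - w).
have n3 := ler_norm2_trd3 (u - w); rewrite fst3B in n1.
rewrite snd3B in n2; rewrite trd3B in n3.
rewrite dotv_triple fst3K snd3K trd3K fst3B snd3B trd3B.
have := P1 _ (le_lt_trans n1 u1); have := P2 _ (le_lt_trans n2 u2).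
have := P3 _ (le_lt_trans n3 u3).
have e30 := ltW e3.
have := ler_wpM2l e30 n1; have := ler_wpM2l e30 n2; have := ler_wpM2l e30 n3.
rewrite !ler_norml => q1 q2 q3 /andP[? ?] /andP[? ?] /andP[? ?].
by apply/andP; split; lra.
Qed.

(** Test points that differ from the base point in a single component isolate that component of
    [g]. *)
Lemma regular_normal_prod3 (A : set 'rV[R]_m) (B : set 'rV[R]_n)
    (D : set 'rV[R]_r) x y z g : A x -> B y -> D z ->
  regular_normal (prod3 A B D) (triple x y z) g ->
  [/\ regular_normal A x (fst3 g), regular_normal B y (snd3 g) &
      regular_normal D z (trd3 g)].
Proof.
move=> Ax By Dz Cg.
have N u e d : 0 < d ->
    (forall w, prod3 A B D w -> norm2 (w - triple x y z) < d ->
       dotv g (w - triple x y z) <= e * norm2 (w - triple x y z)) ->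
    prod3 A B D (u + triple x y z) -> norm2 u < d -> dotv g u <= e * norm2 u.
  by move=> d0 P Cu ud; have := P _ Cu; rewrite addrK => /(_ ud).
have norm_eq k (a : 'rV[R]_k) u : norm2 u ^+ 2 = norm2 a ^+ 2 -> norm2 u = norm2 a.
  by move=> /eqP; rewrite eqrXn2 ?norm2_ge0// => /eqP.
have add x1 y1 z1 : triple x1 y1 z1 + triple x y z = triple (x1 + x) (y1 + y) (z1 + z).
  by rewrite /triple !add_row_mx.
split=> e /Cg[d d0 dP]; exists d => // a Aa ad.
- have E : norm2 (triple (a - x) (0 : 'rV[R]_n) (0 : 'rV[R]_r)) = norm2 (a - x).
    apply: norm_eq; rewrite sqr_norm2_triple fst3K snd3K trd3K !norm2_0.
    by rewrite expr0n/= !addr0.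
  have := N (triple (a - x) 0 0) e d d0 dP; rewrite E add subrK !add0r.
  rewrite dotv_triple fst3K snd3K trd3K !dotv0r !addr0; apply=> //.
  by exists a, y, z.
- have E : norm2 (triple (0 : 'rV[R]_m) (a - y) (0 : 'rV[R]_r)) = norm2 (a - y).
    apply: norm_eq; rewrite sqr_norm2_triple fst3K snd3K trd3K !norm2_0.
    by rewrite expr0n/= addr0 add0r.
  have := N (triple 0 (a - y) 0) e d d0 dP; rewrite E add subrK !add0r.
  rewrite dotv_triple fst3K snd3K trd3K !dotv0r addr0 add0r; apply=> //.
  by exists x, a, z.
- have E : norm2 (triple (0 : 'rV[R]_m) (0 : 'rV[R]_n) (a - z)) = norm2 (a - z).
    apply: norm_eq; rewrite sqr_norm2_triple fst3K snd3K trd3K !norm2_0.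
    by rewrite expr0n/= !add0r.
  have := N (triple 0 0 (a - z)) e d d0 dP; rewrite E add subrK !add0r.
  rewrite dotv_triple fst3K snd3K trd3K !dotv0r !add0r; apply=> //.
  by exists x, y, a.
Qed.

End TripleTheory.

Arguments fst3 {R m n r}.
Arguments snd3 {R m n r}.
Arguments trd3 {R m n r}.

(** * Descent of one parallel proximal step *)

Section BlockProx.
Variables (R : realType) (N : nat) (p : 'I_N -> nat)
  (A : forall i, set 'rV[R]_(p i)) (f : 'rV[R]_(\sum_i p i) -> R)
  (L a : 'I_N -> R).

Definition block_prox x x' := forall i, argmin (@A i) (fun u =>
  dotv (u - submxrow x i) (block_grad f i x)
  + a i / 2 * norm2 (u - submxrow x i) ^+ 2) (submxrow x' i).

(** Comparison of each new block with the old one bounds the linear term by [- a i / 2] times the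
    squared displacement; [block_descent] gives back only [L i / 2]. *)
Lemma block_prox_descent x x' c : (forall i, block_grad_lipschitz A f i (L i)) ->
  separable_grad A f -> block_prod A x -> block_prox x x' ->
  (forall i, c <= (a i - L i) / 2) ->
  f x' + c * norm2 (x' - x) ^+ 2 <= f x.
Proof.
move=> f_lip f_sep Ax xx' ca.
have Ax' : block_prod A x' by move=> i; case: (xx' i).
apply: (le_trans (lerD (block_descent f_lip f_sep Ax Ax') (lexx _))).
rewrite -addrA gerDl sqr_norm2_blocks mulr_sumr -big_split/=.
apply: sumr_le0 => i _; rewrite submxrowB.
have := (xx' i).2 _ (Ax i); rewrite subrr dotv0l norm2_0 expr0n/= mulr0 addr0.
have := ler_wpM2r (sqr_ge0 (norm2 (submxrow x' i - submxrow x i))) (ca i).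
lra.
Qed.

End BlockProx.

Lemma closed_block_prod (R : realType) (N : nat) (p : 'I_N -> nat)
    (A : forall i, set 'rV[R]_(p i)) :
  (forall i, closed (A i)) -> closed (block_prod A).
Proof.
move=> cA; have -> : block_prod A = \bigcap_i ((fun x => submxrow x i) @^-1` (A i)).
  by apply/seteqP; split=> [x Ax i _|x Ax i]; exact: Ax.
apply: closed_bigI => i _; apply: closed_preimage_nonexpansive => // u v.
by rewrite -submxrowB ler_norm2_block.
Qed.

Section Prod3.
Variables (R : realType) (m n r : nat) (A : set 'rV[R]_m) (B : set 'rV[R]_n)
  (D : set 'rV[R]_r).

Lemma prod3P w : prod3 A B D w <-> [/\ A (fst3 w), B (snd3 w) & D (trd3 w)].
Proof.
split=> [[x [y [z [Ax By Dz ->]]]]|[Aw Bw Dw]].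
  by rewrite fst3K snd3K trd3K.
by exists (fst3 w), (snd3 w), (trd3 w); split => //; rewrite triple_eta.
Qed.

Lemma closed_prod3 : closed A -> closed B -> closed D -> closed (prod3 A B D).
Proof.
move=> cA cB cD; have -> : prod3 A B D =
    fst3 @^-1` A `&` snd3 @^-1` B `&` trd3 @^-1` D.
  apply/seteqP; split=> w; first by move=> /prod3P[].
  by move=> [[? ?] ?]; apply/prod3P.
apply: closedI; first apply: closedI.
- exact: (closed_preimage_nonexpansive (phi := fst3) (@fst3_nonexpansive _ _ _ _) cA).
- exact: (closed_preimage_nonexpansive (phi := snd3) (@snd3_nonexpansive _ _ _ _) cB).
- exact: (closed_preimage_nonexpansive (phi := trd3) (@trd3_nonexpansive _ _ _ _) cD).
Qed.

End Prod3.

(** * The algorithm: sufficient descent and surrogates *)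

Section ImplicitExplicit.
Variables (R : realType) (P Q : nat) (p : 'I_P -> nat) (q : 'I_Q -> nat)
  (r : nat).
Variables (X : forall i, set 'rV[R]_(p i)) (Y : forall j, set 'rV[R]_(q j))
  (Z : set 'rV[R]_r) (F : 'rV[R]_(\sum_i p i + \sum_j q j + r) -> R).
Variables (Lx : 'I_P -> 'rV[R]_(\sum_j q j) -> 'rV[R]_r -> R)
  (Ly : 'I_Q -> 'rV[R]_(\sum_i p i) -> 'rV[R]_r -> R)
  (etax : 'I_P -> R) (etay : 'I_Q -> R)
  (alpha : 'I_P -> R) (beta : 'I_Q -> R) (gamma : R)
  (x : nat -> 'rV[R]_(\sum_i p i)) (y : nat -> 'rV[R]_(\sum_j q j))
  (z : nat -> 'rV[R]_r).
Let C := prod3 (block_prod X) (block_prod Y) Z.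
Let w k := triple (x k) (y k) (z k).

Hypothesis xyz_gen :
  generated_by_algorithm X Y Z F Lx Ly etax etay alpha beta gamma x y z.
Hypothesis gamma_gt0 : 0 < gamma.

Lemma iterate_mem k : [/\ block_prod X (x k), block_prod Y (y k) & Z (z k)].
Proof.
have [init xs ys zs] := xyz_gen; case: k => [//|k].
by split=> [i|j|]; [case: (xs k i)|case: (ys k j)|case: (zs k)].
Qed.

Lemma iterate_C k l s : C (triple (x k) (y l) (z s)).
Proof.
have [xk _ _] := iterate_mem k; have [_ yl _] := iterate_mem l.
by have [_ _ zs] := iterate_mem s; exists (x k), (y l), (z s).
Qed.

(** The left-hand side is free of [L]: the safeguard [e] makes the descent constant uniform over the
    iterations. *)
Lemma prox_gap (a L e : R) : 1 < a -> 0 < e ->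
  (a - 1) * e / 2 <= (a * Num.max L e - L) / 2.
Proof.
move=> a1 e0; have Le : L <= Num.max L e by rewrite le_max lexx.
have ee : e <= Num.max L e by rewrite le_max lexx orbT.
have a10 : 0 <= a - 1 by lra.
by have := ler_wpM2l a10 ee; lra.
Qed.

Lemma iterate_descent :
  (forall i, 0 < etax i) -> (forall j, 0 < etay j) ->
  (forall i, 1 < alpha i) -> (forall j, 1 < beta j) ->
  (forall i y' z', block_prod Y y' -> Z z' ->
     block_grad_lipschitz X (fun x' => F (triple x' y' z')) i (Lx i y' z')) ->
  (forall j x' z', block_prod X x' -> Z z' ->
     block_grad_lipschitz Y (fun y' => F (triple x' y' z')) j (Ly j x' z')) ->
  (forall y' z', block_prod Y y' -> Z z' ->
     separable_grad X (fun x' => F (triple x' y' z'))) ->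
  (forall x' z', block_prod X x' -> Z z' ->
     separable_grad Y (fun y' => F (triple x' y' z'))) ->
  exists2 c, 0 < c & forall k, F (w k.+1) + c * norm2 (w k.+1 - w k) ^+ 2 <= F (w k).
Proof.
move=> etax0 etay0 alpha1 beta1 Lx_lip Ly_lip x_sep y_sep.
have [|cx cx0 cxP] := @finite_lower_bound _ _ (fun i => (alpha i - 1) * etax i / 2).
  by move=> i; rewrite divr_gt0// mulr_gt0// subr_gt0.
have [|cy cy0 cyP] := @finite_lower_bound _ _ (fun j => (beta j - 1) * etay j / 2).
  by move=> j; rewrite divr_gt0// mulr_gt0// subr_gt0.
have [c c0 [c_x c_y c_z]] : exists2 c, 0 < c & [/\ c <= cx, c <= cy & c <= gamma / 2].
  exists (Num.min cx (Num.min cy (gamma / 2))).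
    by rewrite !lt_min cx0 cy0 divr_gt0.
  by rewrite !ge_min !lexx !orbT.
exists c => // k; have [_ xs ys zs] := xyz_gen.
have [xk yk zk] := iterate_mem k; have [xk1 yk1 zk1] := iterate_mem k.+1.
have Hx := block_prox_descent (fun i => Lx_lip i _ _ yk zk) (x_sep _ _ yk zk) xk
  (xs k) (fun i => le_trans (cxP i) (prox_gap (Lx i (y k) (z k)) (alpha1 i) (etax0 i))).
have Hy := block_prox_descent (fun j => Ly_lip j _ _ xk1 zk) (y_sep _ _ xk1 zk) yk
  (ys k) (fun j => le_trans (cyP j) (prox_gap (Ly j (x k.+1) (z k)) (beta1 j) (etay0 j))).
have Hz := (zs k).2 _ zk; rewrite subrr norm2_0 expr0n/= mulr0 addr0 in Hz.
rewrite sqr_norm2_triple tripleB fst3K snd3K trd3K /w.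
have := ler_wpM2r (sqr_ge0 (norm2 (x k.+1 - x k))) c_x.
have := ler_wpM2r (sqr_ge0 (norm2 (y k.+1 - y k))) c_y.
have := ler_wpM2r (sqr_ge0 (norm2 (z k.+1 - z k))) c_z.
by lra.
Qed.

(* The three subproblems add up to a single surrogate minimized over C. *)
Lemma iterate_surrogate :
  (forall u, C u -> differentiable F u) ->
  (forall B : set 'rV[R]_(\sum_i p i + \sum_j q j + r),
     B `<=` C -> bounded_set B -> exists M : R, forall u v, B u -> B v ->
       norm2 (grad F u - grad F v) <= M * norm2 (u - v)) ->
  (exists W, forall k, norm2 (w k) <= W) ->
  (forall i, 0 < etax i) -> (forall j, 0 < etay j) ->
  (forall i, 1 < alpha i) -> (forall j, 1 < beta j) ->
  (exists lambdax, forall i k, Lx i (y k) (z k) <= lambdax i) ->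
  (exists lambday, forall j k, Ly j (x k.+1) (z k) <= lambday j) ->
  surrogate_steps C (grad F) w.
Proof.
move=> Fdiff Flip [W wW] etax0 etay0 alpha1 beta1.
move=> [lambdax Lxb] [lambday Lyb] rho.
pose ax i k := alpha i * Num.max (Lx i (y k) (z k)) (etax i).
pose ay j k := beta j * Num.max (Ly j (x k.+1) (z k)) (etay j).
have [Ax Ax0 AxP] :=
  finite_upper_bound (fun i => alpha i * Num.max (lambdax i) (etax i)).
have [Ay Ay0 AyP] :=
  finite_upper_bound (fun j => beta j * Num.max (lambday j) (etay j)).
have coef (a e L l A : R) : 1 < a -> 0 < e -> L <= l -> a * Num.max l e <= A ->
    `|a * Num.max L e| <= A.
  move=> a1 e0 Ll; have a0 : 0 <= a by lra.
  rewrite ger0_norm ?mulr_ge0//; last by rewrite le_max (ltW e0) orbT.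
  by apply: le_trans; rewrite ler_wpM2l// ge_max !le_max Ll lexx orbT.
have axA i k : `|ax i k| <= Ax by apply: coef (AxP i).
have ayA j k : `|ay j k| <= Ay by apply: coef (AyP j).
(* The radius is large enough for all the points where gradients are compared: [u], [w k], [mid1] of
   norm at most [3 * W], and [mid2] of norm at most [2 * rho + W]. *)
pose B0 := C `&` [set u | norm2 u <= 2 * rho + 4 * W].
have [M0 M0P] : exists M : R, forall u v, B0 u -> B0 v ->
    norm2 (grad F u - grad F v) <= M * norm2 (u - v).
  apply: Flip; first exact: subIsetl.
  by apply/bounded_norm2P; exists (2 * rho + 4 * W) => u [].
pose M := `|M0|; have M_ge0 : 0 <= M by exact: normr_ge0.
have MP u v : B0 u -> B0 v -> norm2 (grad F u - grad F v) <= M * norm2 (u - v).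
  move=> Bu Bv; apply: (le_trans (M0P _ _ Bu Bv)).
  by rewrite ler_wpM2r ?norm2_ge0// ler_norm.
exists (3 * M + Ax + Ay + gamma).
  by rewrite !addr_ge0 ?mulr_ge0// ltW.
move=> k; have [_ xs ys zs] := xyz_gen.
pose fx x' := F (triple x' (y k) (z k)).
pose fy y' := F (triple (x k.+1) y' (z k)).
pose gx i := block_grad fx i (x k); pose gy j := block_grad fy j (y k).
pose mx i (u : 'rV[R]_(p i)) := dotv (u - submxrow (x k) i) (gx i) +
  ax i k / 2 * norm2 (u - submxrow (x k) i) ^+ 2.
pose my j (u : 'rV[R]_(q j)) := dotv (u - submxrow (y k) j) (gy j) +
  ay j k / 2 * norm2 (u - submxrow (y k) j) ^+ 2.
pose mz u := F (triple (x k.+1) (y k.+1) u) +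
  (dotv (u - z k) 0 + gamma / 2 * norm2 (u - z k) ^+ 2).
pose G u := (\sum_i mx i (submxrow (fst3 u) i)) +
  (\sum_j my j (submxrow (snd3 u) j)) + mz (trd3 u).
pose gG u := triple
  (\mxrow_i (gx i + ax i k *: (submxrow (fst3 u) i - submxrow (x k) i)))
  (\mxrow_j (gy j + ay j k *: (submxrow (snd3 u) j - submxrow (y k) j)))
  (trd3 (grad F (triple (x k.+1) (y k.+1) (trd3 u))) +
     (0 + gamma *: (trd3 u - z k))).
have C_mid u : C u -> C (triple (x k.+1) (y k.+1) (trd3 u)).
  move=> /prod3P[_ _ Zu]; have [x1 y1 _] := iterate_mem k.+1.
  by exists (x k.+1), (y k.+1), (trd3 u).
exists G, gG; split=> [u /prod3P[Xu Yu Zu]|u Cu urho].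
  rewrite /G /w fst3K snd3K trd3K; apply: lerD; first apply: lerD.
  - by apply: ler_sum => i _; apply: (xs k i).2; exact: Xu.
  - by apply: ler_sum => j _; apply: (ys k j).2; exact: Yu.
  - by rewrite /mz !dotv0r !add0r; exact: (zs k).2.
split.
  apply: (@has_grad_triple _ _ _ _ (fun x' => \sum_i mx i (submxrow x' i))
    (fun y' => \sum_j my j (submxrow y' j)) mz).
  - by apply: has_grad_blocks => i; exact: has_grad_prox.
  - by apply: has_grad_blocks => j; exact: has_grad_prox.
  - apply: has_gradD; last exact: has_grad_prox.
    by apply: has_grad_trd3; apply/differentiable_has_grad/Fdiff/C_mid.
have W0 : 0 <= W := le_trans (norm2_ge0 _) (wW 0%N).
have rho0 : 0 <= rho := le_trans (norm2_ge0 _) urho.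
have Bu : B0 u by split => //=; lra.
have Bw : B0 (w k) by split; [exact: iterate_C|have := wW k; rewrite /=; lra].
(* The three components of [gG] use the gradient of [F] at [w k], [mid1] and [mid2] respectively,
   since each substep starts from the result of the previous ones. *)
pose mid1 := triple (x k.+1) (y k) (z k).
pose mid2 := triple (x k.+1) (y k.+1) (trd3 u).
have step0 := norm2_ge0 (w k.+1 - w k).
have dist1 : norm2 (mid1 - w k) <= norm2 (w k.+1 - w k).
  apply: ler_norm2_sqr; rewrite !sqr_norm2_triple /mid1 /w !tripleB.
  rewrite !fst3K !snd3K !trd3K !subrr !norm2_0 expr0n/= !addr0 -addrA lerDl.
  by rewrite addr_ge0 ?sqr_ge0.
have dist2 : norm2 (u - mid2) <= norm2 (u - w k.+1).
  apply: ler_norm2_sqr; rewrite !sqr_norm2_triple !fst3B !snd3B !trd3B.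
  rewrite /mid2 /w !fst3K !snd3K !trd3K subrr norm2_0 expr0n/= addr0.
  by rewrite lerDl sqr_ge0.
have wk := wW k; have wk1 := wW k.+1; have stepW := ler_norm2B (w k.+1) (w k).
have Bmid1 : B0 mid1.
  split; first exact: iterate_C.
  by have := ler_norm2D (mid1 - w k) (w k); rewrite subrK /=; lra.
have Bmid2 : B0 mid2.
  split; first exact: C_mid.
  have := ler_norm2D (mid2 - u) u; rewrite subrK norm2B /=.
  by have := ler_norm2B u (w k.+1); lra.
set s0 := norm2 (u - w k); set d := norm2 (w k.+1 - w k) in step0 dist1 stepW *.
have s0_ge0 : 0 <= s0 by exact: norm2_ge0.
have du1 : norm2 (u - mid1) <= s0 + d.
  by have := ler_norm2_dist (w k) u mid1; rewrite (norm2B (w k)) -/s0; lra.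
have du2 : norm2 (u - mid2) <= s0 + d.
  apply: (le_trans dist2).
  by have := ler_norm2_dist (w k) u (w k.+1); rewrite (norm2B (w k)) -/s0 -/d; lra.
apply: (le_trans (ler_norm2_triple _)).
rewrite fst3B snd3B trd3B /gG fst3K snd3K trd3K.
have gxE : \mxrow_i (gx i + ax i k *: (submxrow (fst3 u) i - submxrow (x k) i)) =
    fst3 (grad F (w k)) + \mxrow_i (ax i k *: submxrow (fst3 u - x k) i).
  apply: submxrow_inj => i; rewrite submxrowD !mxrowK submxrowB.
  by rewrite /gx block_gradE /fx grad_fst3.
have gyE : \mxrow_j (gy j + ay j k *: (submxrow (snd3 u) j - submxrow (y k) j)) =
    snd3 (grad F mid1) + \mxrow_j (ay j k *: submxrow (snd3 u - y k) j).
  apply: submxrow_inj => j; rewrite submxrowD !mxrowK submxrowB.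
  by rewrite /gy block_gradE /fy grad_snd3.
have part l (a b c : 'rV[R]_l) A B : norm2 (a - b) <= A -> norm2 c <= B ->
    norm2 (a - (b + c)) <= A + B.
  move=> aA cB; rewrite opprD addrA; apply: (le_trans (ler_norm2B _ _)).
  exact: lerD.
have Hx : norm2 (fst3 (grad F u) - (fst3 (grad F (w k)) +
    \mxrow_i (ax i k *: submxrow (fst3 u - x k) i))) <= M * s0 + Ax * s0.
  apply: part.
    by rewrite -fst3B; apply: (le_trans (ler_norm2_fst3 _)); exact: MP.
  apply: (le_trans (norm2_block_scale _ (axA^~ k) Ax0)); rewrite ler_wpM2l//.
  by rewrite -{1}(fst3K (x k) (y k) (z k)) -fst3B ler_norm2_fst3.
have Hy : norm2 (snd3 (grad F u) - (snd3 (grad F mid1) +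
    \mxrow_j (ay j k *: submxrow (snd3 u - y k) j))) <= M * (s0 + d) + Ay * s0.
  apply: part.
    rewrite -snd3B; apply: (le_trans (ler_norm2_snd3 _)).
    by apply: (le_trans (MP _ _ Bu Bmid1)); rewrite ler_wpM2l.
  apply: (le_trans (norm2_block_scale _ (ayA^~ k) Ay0)); rewrite ler_wpM2l//.
  by rewrite -{1}(snd3K (x k) (y k) (z k)) -snd3B ler_norm2_snd3.
have Hz : norm2 (trd3 (grad F u) - (trd3 (grad F mid2) +
    (0 + gamma *: (trd3 u - z k)))) <= M * (s0 + d) + gamma * s0.
  apply: part.
    rewrite -trd3B; apply: (le_trans (ler_norm2_trd3 _)).
    by apply: (le_trans (MP _ _ Bu Bmid2)); rewrite ler_wpM2l.
  rewrite add0r norm2Z gtr0_norm// ler_wpM2l ?(ltW gamma_gt0)//.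
  by rewrite -{1}(trd3K (x k) (y k) (z k)) -trd3B ler_norm2_trd3.
rewrite gxE gyE; apply: (le_trans (lerD (lerD Hx Hy) Hz)).
have gamma_ge0 := ltW gamma_gt0.
have := mulr_ge0 M_ge0 step0; have := mulr_ge0 Ax0 step0.
have := mulr_ge0 Ay0 step0; have := mulr_ge0 gamma_ge0 step0.
by rewrite -/s0 -/d; lra.
Qed.

Lemma Psi_indicator u : Psi X Y Z F u = if u \in C then (F u)%:E else +oo%E.
Proof.
rewrite /Psi /iota_set -/(fst3 u) -/(snd3 u) -/(trd3 u).
have [/set_mem/prod3P[Xu Yu Zu]|uC] := boolP (u \in C).
  by rewrite !mem_set// !adde0.
case: ifPn => [/set_mem Xu|_]; last by case: ifP; case: ifP.
case: ifPn => [/set_mem Yu|_]; last by case: ifP.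
case: ifPn => [/set_mem Zu|//]; case/negP: uC; apply/mem_set/prod3P.
by split.
Qed.

End ImplicitExplicit.

(** * Finite length and the limiting optimality condition *)

Lemma nneseries_bounded (R : realType) (a : nat -> R) M : (forall k, 0 <= a k) ->
  (forall N, \sum_(0 <= k < N) a k <= M) -> (\sum_(1 <= k <oo) (a k)%:E < +oo)%E.
Proof.
move=> a0 aM; apply: (@le_lt_trans _ _ M%:E); last exact: ltry.
apply: lime_le; first by apply: is_cvg_nneseries => k _ _; rewrite lee_fin.
apply: nearW => N; rewrite sumEFin lee_fin; apply: le_trans (aM N).
case: N => [|N]; first by rewrite !big_geq.
by rewrite [leRHS]big_ltn// lerDr.
Qed.

Unset Implicit Arguments.

Theorem theorem3p10 (R : realType) (P Q : nat)
  (p : 'I_P -> nat) (q : 'I_Q -> nat) (r : nat)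
  (X : forall i : 'I_P, set 'rV[R]_(p i))
  (Y : forall j : 'I_Q, set 'rV[R]_(q j))
  (Z : set 'rV[R]_r)
  (F : 'rV[R]_(\sum_i p i + \sum_j q j + r) -> R)
  (Lx : 'I_P -> 'rV[R]_(\sum_j q j) -> 'rV[R]_r -> R)
  (Ly : 'I_Q -> 'rV[R]_(\sum_i p i) -> 'rV[R]_r -> R)
  (etax : 'I_P -> R) (etay : 'I_Q -> R)
  (alpha : 'I_P -> R) (beta : 'I_Q -> R) (gamma : R)
  (x : nat -> 'rV[R]_(\sum_i p i))
  (y : nat -> 'rV[R]_(\sum_j q j))
  (z : nat -> 'rV[R]_r)
  (P_gt0 : (0 < P)%N) (Q_gt0 : (0 < Q)%N)
  (etax_gt0 : forall i, 0 < etax i) (etay_gt0 : forall j, 0 < etay j)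
  (alpha_gt1 : forall i, 1 < alpha i) (beta_gt1 : forall j, 1 < beta j)
  (gamma_gt0 : 0 < gamma)
  (xyz_gen : generated_by_algorithm X Y Z F Lx Ly etax etay alpha beta gamma
               x y z)
  (* (i) *)
  (p_gt0 : forall i, (0 < p i)%N) (q_gt0 : forall j, (0 < q j)%N)
  (r_gt0 : (0 < r)%N)
  (X_closed : forall i, X i !=set0 /\ closed (X i))
  (Y_closed : forall j, Y j !=set0 /\ closed (Y j))
  (Z_closed : Z !=set0 /\ closed Z)
  (* (ii) *)
  (F_diff : forall w, prod3 (block_prod X) (block_prod Y) Z w ->
     differentiable F w)
  (F_bounded_below : (-oo < ereal_inf (range (fun w => (F w)%:E)))%E)
  (Lx_lip : forall i y' z', block_prod Y y' -> Z z' ->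
     block_grad_lipschitz X (fun x' => F (triple x' y' z')) i (Lx i y' z'))
  (Ly_lip : forall j x' z', block_prod X x' -> Z z' ->
     block_grad_lipschitz Y (fun y' => F (triple x' y' z')) j (Ly j x' z'))
  (* (iii) *)
  (gradF_lip : forall B : set 'rV[R]_(\sum_i p i + \sum_j q j + r),
     B `<=` prod3 (block_prod X) (block_prod Y) Z -> bounded_set B ->
     exists M : R, forall w w', B w -> B w' ->
       norm2 (grad F w - grad F w') <= M * norm2 (w - w'))
  (Lx_bounded : exists lambdax : 'I_P -> R, forall i, 0 < lambdax i /\
     (ereal_sup (range (fun k => (Lx i (y k) (z k))%:E)) <= (lambdax i)%:E)%E)
  (Ly_bounded : exists lambday : 'I_Q -> R, forall j, 0 < lambday j /\
     (ereal_sup (range (fun k => (Ly j (x k.+1) (z k))%:E))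
        <= (lambday j)%:E)%E)
  (* (iv) *)
  (xyz_bounded : bounded_set (range (fun k => triple (x k) (y k) (z k))))
  (* (v) *)
  (Psi_KL : KL_function (Psi X Y Z F))
  (* (vi) *)
  (x_separable : forall y' z', block_prod Y y' -> Z z' ->
     separable_grad X (fun x' => F (triple x' y' z')))
  (* (vii) *)
  (y_separable : forall x' z', block_prod X x' -> Z z' ->
     separable_grad Y (fun y' => F (triple x' y' z'))) :
  (* (a) *)
  (\sum_(1 <= k <oo) (norm2 (triple (x k.+1) (y k.+1) (z k.+1)
                              - triple (x k) (y k) (z k)))%:E < +oo)%E /\
  (* (b) *)
  exists xs ys zs,
    triple (x k) (y k) (z k) @[k --> \oo] --> triple xs ys zs /\
    exists2 v, prod3 (limiting_subdiff (iota_set (block_prod X)) xs)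
                     (limiting_subdiff (iota_set (block_prod Y)) ys)
                     (limiting_subdiff (iota_set Z) zs) v &
               0 = grad F (triple xs ys zs) + v.
Proof.
set C := prod3 (block_prod X) (block_prod Y) Z.
pose w k := triple (x k) (y k) (z k).
have Cw k : C (w k) by exact: (iterate_C xyz_gen).
have cC : closed C.
  apply: closed_prod3; last exact: Z_closed.2.
    by apply: closed_block_prod => i; exact: (X_closed i).2.
  by apply: closed_block_prod => j; exact: (Y_closed j).2.
have F_grad u : C u -> has_grad F u (grad F u).
  by move=> /F_diff; exact: differentiable_has_grad.
have [W wW] : exists W, forall k, norm2 (w k) <= W.
  have /bounded_norm2P[W WP] := xyz_bounded.
  by exists W => k; apply: WP; exists k.
have [lambdax lambdaxP] := Lx_bounded; have [lambday lambdayP] := Ly_bounded.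
have [c c_gt0 descent] := iterate_descent xyz_gen gamma_gt0 etax_gt0 etay_gt0
  alpha_gt1 beta_gt1 Lx_lip Ly_lip x_separable y_separable.
have surrogate : surrogate_steps C (grad F) w.
  apply: (iterate_surrogate xyz_gen) => //.
  - by exists W.
  - exists lambdax => i k; rewrite -lee_fin; apply: le_trans (lambdaxP i).2.
    by apply: ereal_sup_ubound; exists k.
  - exists lambday => j k; rewrite -lee_fin; apply: le_trans (lambdayP j).2.
    by apply: ereal_sup_ubound; exists k.
have [wbar [Cwbar w_cvg [M lengthM] [v [v0 v_normal]]]] :=
  surrogate_descent_convergence cC F_grad c_gt0 Cw (ex_intro _ W wW) descent
    surrogate (Psi_indicator X Y Z F) Psi_KL.
split.
  by apply: (nneseries_bounded _ lengthM) => k; exact: norm2_ge0.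
exists (fst3 wbar), (snd3 wbar), (trd3 wbar); rewrite triple_eta; split=> //.
exists (- grad F wbar); last by rewrite subrr.
(* These are regular normals to [C] at the iterates; as [v] tends to 0, they converge to
   [- grad F wbar]. *)
pose n k := v k - grad F (w k.+1).
have wS_cvg : w k.+1 @[k --> \oo] --> wbar by rewrite (cvg_shiftS w).
have n_cvg : n k @[k --> \oo] --> - grad F wbar.
  rewrite -[X in _ --> X]sub0r; apply: cvgB => //.
  (* A bounded part of [C] containing the iterates and their limit, on which [grad F] is
     Lipschitz. *)
  pose B := C `&` [set u | norm2 u <= Num.max W (norm2 wbar)].
  have [|L LP] := gradF_lip B (@subIsetl _ _ _).
    by apply/bounded_norm2P; exists (Num.max W (norm2 wbar)) => u [].
  have L1 : 0 < `|L| + 1 by rewrite ltr_wpDl.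
  apply/cvg_norm2P => e e0; have eL : 0 < e / (`|L| + 1) by rewrite divr_gt0.
  have /cvg_norm2P/(_ _ eL) := wS_cvg; apply: filterS => k; rewrite ltr_pdivlMr// => wk.
  apply: le_lt_trans wk; apply: (le_trans (LP _ _ _ _)).
  - by split; [exact: Cw|rewrite /= le_max wW].
  - by split; [exact: Cwbar|rewrite /= le_max lexx orbT].
  rewrite mulrC ler_wpM2l ?norm2_ge0// (le_trans (ler_norm L))//.
  by rewrite lerDl ler01.
have [/prod3P[Xw Yw Zw] iterP] := (Cwbar, iterate_mem xyz_gen).
have normalP k : [/\ regular_normal (block_prod X) (x k.+1) (fst3 (n k)),
    regular_normal (block_prod Y) (y k.+1) (snd3 (n k)) &
    regular_normal Z (z k.+1) (trd3 (n k))].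
  have [xk yk zk] := iterP k.+1; exact: regular_normal_prod3 (v_normal k).
(* In each factor the limiting subgradient is the limit of the corresponding components of [n k]. *)
apply/prod3P; split.
- apply: (limiting_subdiff_iota (us := fun k => x k.+1) (vs := fst3 \o n)) => //.
  + by move=> k; have [] := iterP k.+1.
  + have -> : (fun k => x k.+1) = fst3 \o (fun k => w k.+1).
      by apply/funext => k; rewrite /= fst3K.
    exact: (cvg_nonexpansive (phi := fst3) (@fst3_nonexpansive _ _ _ _) wS_cvg).
  + exact: (cvg_nonexpansive (phi := fst3) (@fst3_nonexpansive _ _ _ _) n_cvg).
  + by move=> k; have [] := normalP k.
- apply: (limiting_subdiff_iota (us := fun k => y k.+1) (vs := snd3 \o n)) => //.
  + by move=> k; have [] := iterP k.+1.
  + have -> : (fun k => y k.+1) = snd3 \o (fun k => w k.+1).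
      by apply/funext => k; rewrite /= snd3K.
    exact: (cvg_nonexpansive (phi := snd3) (@snd3_nonexpansive _ _ _ _) wS_cvg).
  + exact: (cvg_nonexpansive (phi := snd3) (@snd3_nonexpansive _ _ _ _) n_cvg).
  + by move=> k; have [] := normalP k.
- apply: (limiting_subdiff_iota (us := fun k => z k.+1) (vs := trd3 \o n)) => //.
  + by move=> k; have [] := iterP k.+1.
  + have -> : (fun k => z k.+1) = trd3 \o (fun k => w k.+1).
      by apply/funext => k; rewrite /= trd3K.
    exact: (cvg_nonexpansive (phi := trd3) (@trd3_nonexpansive _ _ _ _) wS_cvg).
  + exact: (cvg_nonexpansive (phi := trd3) (@trd3_nonexpansive _ _ _ _) n_cvg).
  + by move=> k; have [] := normalP k.
Qed.
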